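(* Let $\mathfrak{T}$ be a Karoubian tensor category over a field $k$. Let $\times$ be the binary operation on $\{1,2,3,4\}$ given by $i\times2=2$, $i\times3=3$, $i\times4=i$ for all $i$, and $1\times1=4$, $2\times1=3$, $3\times1=2$, $4\times1=1$. If $A$ and $B$ are Delannic algebras in $\mathfrak{T}$ of types $i$ and $j$, then the lexicographic product $A\otimes B$ is Delannic of type $i\times j$.
   Context: **Tensor categories.** A tensor category is an additive $k$-linear category with a $k$-bilinear symmetric monoidal structure, with unit $\mathbf{1}$; $\Gamma(X)=\mathrm{Hom}(\mathbf{1},X)$. Karoubian means idempotents split. **Étale algebras.** Algebras are commutative, associative, unital; unit $\eta_A$, multiplication $m_A$. For a rigid algebra $A$, $\epsilon_A\colon A\to\mathbf{1}$ is the trace map (composite of $A\to A\otimes A^\vee$, adjoint to multiplication, with evaluation). $A$ is étale if it is rigid and $\epsilon_A\circ m_A$ is a perfect pairing. $\mathrm{Et}(\mathfrak{T})$ is the category of étale algebras and algebra maps. For $f\colon A\to B$ in $\mathrm{Et}(\mathfrak{T})$, $f^\vee\colon B\to A$ is the dual map under the trace pairings, $\tilde\gamma(f)=f^\vee\circ\eta_B\in\Gamma(A)$; $f$ is uniform if $A\ne0$ and $\tilde\gamma(f)\in k\cdot\eta_A$, and then $\gamma(f)\in k$ is that scalar. **Ordered étale algebras.** $\mathrm{Et}(\mathfrak{T})^{\mathrm{op}}$ is lextensive (finite limits, and finite coproducts such that $\mathcal{S}_{/X}\times\mathcal{S}_{/Y}\to\mathcal{S}_{/(X\amalg Y)}$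 is an equivalence). A total order on an object $X$ of a lextensive category is a subobject $R_X\subset X\times X$ such that $R_X\amalg\Delta_X\amalg R_X^{\mathrm{op}}\to X\times X$ is an isomorphism ($R_X^{\mathrm{op}}$ = image under the switch) and $R_{12}\cap R_{23}\subset R_{13}$ in $X^3$ ($R_{ij}$ the inverse image of $R_X$ under the projection to coordinates $i,j$); think of $R_X$ as ''$x<y$''. An ordered étale algebra is an ordered object of $\mathrm{Et}(\mathfrak{T})^{\mathrm{op}}$. For such $A$, $A^{(2)}$ is the direct factor of $A\otimes A$ corresponding to $R$, and $\pi^1_A,\pi_A^2\colon A\to A^{(2)}$ are the composites of $x\mapsto x\otimes1$, resp. $x\mapsto1\otimes x$, with $A\otimes A\to A^{(2)}$. The lexicographic product of ordered objects $X,Y$ is $X\times Y$ with order $(R_X\times Y\times Y)\amalg(\Delta_X\times R_Y)\subset X^2\times Y^2\cong(X\times Y)^2$ (compare the $X$-coordinate first, then the $Y$-coordinate); for étale algebras the product in $\mathrm{Et}(\mathfrak{T})^{\mathrm{op}}$ is $A\otimes B$. **Delannic algebras.** A non-zero ordered étale algebra $A$ is Delannic if $\eta_A,\pi^1_A,\pi^2_A$ are uniform. In this case $(\dim A,\gamma(\pi_A^2),\gamma(\pi_A^1))$ is one of $(-1,-1,-1)$, $(0,-1,0)$, $(0,0,-1)$, $(1,0,0)$, and $A$ is said to have type $1,2,3,4$ respectively. The zero algebra is also Delannic, and is considered to have both type 2 and type 3. *)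

(* Defs.v *)
From HB Require Import structures.
From mathcomp Require Import all_boot all_algebra.

Set Implicit Arguments.
Unset Strict Implicit.
Unset Printing Implicit Defensive.

Import GRing.Theory.
Local Open Scope ring_scope.

Declare Scope tcat_scope.
Delimit Scope tcat_scope with tcat.
Local Open Scope tcat_scope.

(* The notions of total order and lexicographic product are meant for         *)
(* lextensive categories.  Limits and coproducts are not chosen, but given    *)
(* by their universal properties.                                             *)

Record category := Category {
  cob :> Type;
  chom : cob -> cob -> Type;
  cid : forall X, chom X X;
  ccomp : forall X Y Z, chom Y Z -> chom X Y -> chom X Z;
  ccompA : forall X Y Z W (h : chom Z W) (g : chom Y Z) (f : chom X Y),
    ccomp h (ccomp g f) = ccomp (ccomp h g) f;
  ccomp1l : forall X Y (f : chom X Y), ccomp (cid Y) f = f;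
  ccomp1r : forall X Y (f : chom X Y), ccomp f (cid X) = f
}.

Arguments chom {_} _ _.
Arguments cid {_} _.
Arguments ccomp {_ _ _ _} _ _.

Notation "g \k f" := (ccomp g f)
  (at level 45, right associativity) : tcat_scope.

Definition opposite (C : category) : category :=
  @Category C (fun X Y => @chom C Y X) (@cid C)
    (fun X Y Z g f => @ccomp C Z Y X f g)
    (fun X Y Z W h g f => esym (@ccompA C W Z Y X f g h))
    (fun X Y f => @ccomp1r C Y X f) (fun X Y f => @ccomp1l C Y X f).

Section OrderedObjects.
Variable S : category.

Definition is_mono (X Y : S) (u : chom X Y) : Prop :=
  forall (T : S) (f g : chom T X), u \k f = u \k g -> f = g.

Definition is_product (X Y P : S) (p1 : chom P X) (p2 : chom P Y) : Prop :=
  forall (T : S) (f : chom T X) (g : chom T Y),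
    exists! h : chom T P, p1 \k h = f /\ p2 \k h = g.

Record product_of (X Y : S) := ProductOf {
  pr_ob :> S;
  pr1 : chom pr_ob X;
  pr2 : chom pr_ob Y;
  pr_univ : is_product pr1 pr2
}.

Definition is_pair (X Y : S) (P : product_of X Y) (T : S)
    (h : chom T P) (f : chom T X) (g : chom T Y) : Prop :=
  pr1 P \k h = f /\ pr2 P \k h = g.

Definition is_pullback (X Y Z P : S) (f : chom X Z) (g : chom Y Z)
    (p : chom P X) (q : chom P Y) : Prop :=
  f \k p = g \k q /\
  forall (T : S) (a : chom T X) (b : chom T Y), f \k a = g \k b ->
    exists! h : chom T P, p \k h = a /\ q \k h = b.

(* The map from the coproduct U + V (resp. U + V + W) to C is an             *)
(* isomorphism if and only if C is itself such a coproduct.                  *)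
Definition is_coproduct2 (U V C : S) (u : chom U C) (v : chom V C) : Prop :=
  forall (T : S) (f : chom U T) (g : chom V T),
    exists! h : chom C T, h \k u = f /\ h \k v = g.

Definition is_coproduct3 (U V W C : S)
    (u : chom U C) (v : chom V C) (w : chom W C) : Prop :=
  forall (T : S) (f : chom U T) (g : chom V T) (e : chom W T),
    exists! h : chom C T, [/\ h \k u = f, h \k v = g & h \k w = e].

Record subobject (X : S) := Subobject {
  sub_ob :> S;
  sub_map : chom sub_ob X;
  sub_mono : is_mono sub_map
}.

Definition sub_le (X : S) (U V : subobject X) : Prop :=
  exists u : chom U V, sub_map V \k u = sub_map U.

Definition is_inverse_image (X Y : S) (f : chom X Y)
    (V : subobject Y) (U : subobject X) : Prop :=
  exists g : chom U V, is_pullback f (sub_map V) (sub_map U) g.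

Definition is_intersection (X : S) (U V W : subobject X) : Prop :=
  exists (a : chom W U) (b : chom W V),
    sub_map U \k a = sub_map W /\ is_pullback (sub_map U) (sub_map V) a b.

Definition order_trichotomy (X : S) (XX : product_of X X)
    (R : subobject XX) : Prop :=
  exists diag : chom X XX, is_pair diag (cid X) (cid X) /\
  exists switch : chom XX XX, is_pair switch (pr2 XX) (pr1 XX) /\
    is_coproduct3 (sub_map R) diag (switch \k sub_map R).

Definition order_transitivity (X : S) (XX : product_of X X)
    (R : subobject XX) : Prop :=
  exists X3 : product_of XX X,
  let x1 := pr1 XX \k pr1 X3 in
  let x2 := pr2 XX \k pr1 X3 in
  let x3 := pr2 X3 in
  exists p12 p23 p13 : chom X3 XX,
    [/\ is_pair p12 x1 x2, is_pair p23 x2 x3 & is_pair p13 x1 x3] /\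
  exists R12 R23 R13 I : subobject X3,
    [/\ is_inverse_image p12 R R12,
        is_inverse_image p23 R R23,
        is_inverse_image p13 R R13,
        is_intersection R12 R23 I & sub_le I R13].

Definition is_total_order (X : S) (XX : product_of X X)
    (R : subobject XX) : Prop :=
  order_trichotomy R /\ order_transitivity R.

(* A map T -> Z x Z, where Z = X x Y, has coordinates ((x1, y1), (x2, y2)). *)
Definition has_coordinates (X Y : S) (Z : product_of X Y) (ZZ : product_of Z Z)
    (T : S) (h : chom T ZZ)
    (x1 : chom T X) (y1 : chom T Y) (x2 : chom T X) (y2 : chom T Y) : Prop :=
  is_pair (P := Z) (pr1 ZZ \k h) x1 y1 /\ is_pair (P := Z) (pr2 ZZ \k h) x2 y2.

(* R = (RX x Y x Y) + (Delta_X x RY), as a subobject of Z x Z. *)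
Definition is_lexicographic (X Y : S)
    (XX : product_of X X) (RX : subobject XX)
    (YY : product_of Y Y) (RY : subobject YY)
    (Z : product_of X Y) (ZZ : product_of Z Z) (R : subobject ZZ) : Prop :=
  exists (P : product_of RX YY) (Q : product_of X RY)
         (i : chom P R) (j : chom Q R),
  [/\ has_coordinates (sub_map R \k i)
        (pr1 XX \k (sub_map RX \k pr1 P)) (pr1 YY \k pr2 P)
        (pr2 XX \k (sub_map RX \k pr1 P)) (pr2 YY \k pr2 P),
      has_coordinates (sub_map R \k j)
        (pr1 Q) (pr1 YY \k (sub_map RY \k pr2 Q))
        (pr1 Q) (pr2 YY \k (sub_map RY \k pr2 Q))
    & is_coproduct2 i j].

End OrderedObjects.

(* Mac Lane's coherence axioms, with the redundant ones lunit_runit and      *)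
(* braid_unit.                                                               *)
Record tensor_category (k : fieldType) := TensorCategory {
  ob :> Type;
  hom : ob -> ob -> lmodType k;
  idm : forall X, hom X X;
  comp : forall X Y Z, hom Y Z -> hom X Y -> hom X Z;
  compA : forall X Y Z W (h : hom Z W) (g : hom Y Z) (f : hom X Y),
    comp h (comp g f) = comp (comp h g) f;
  comp1l : forall X Y (f : hom X Y), comp (idm Y) f = f;
  comp1r : forall X Y (f : hom X Y), comp f (idm X) = f;

  comp_linear_l : forall X Y Z (f : hom X Y) (a : k) (u v : hom Y Z),
    comp (a *: u + v) f = a *: comp u f + comp v f;
  comp_linear_r : forall X Y Z (g : hom Y Z) (a : k) (u v : hom X Y),
    comp g (a *: u + v) = a *: comp g u + comp g v;
  has_zero_object : exists Z, idm Z = 0;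
  has_biproducts : forall X Y, exists P
    (i1 : hom X P) (i2 : hom Y P) (p1 : hom P X) (p2 : hom P Y),
    [/\ comp p1 i1 = idm X, comp p2 i2 = idm Y,
        comp p1 i2 = 0, comp p2 i1 = 0
      & comp i1 p1 + comp i2 p2 = idm P];

  unit_ob : ob;
  tens : ob -> ob -> ob;
  tensm : forall X X' Y Y', hom X X' -> hom Y Y' -> hom (tens X Y) (tens X' Y');
  tensm1 : forall X Y, tensm (idm X) (idm Y) = idm (tens X Y);
  tensm_comp : forall X X' X'' Y Y' Y''
    (f' : hom X' X'') (f : hom X X') (g' : hom Y' Y'') (g : hom Y Y'),
    tensm (comp f' f) (comp g' g) = comp (tensm f' g') (tensm f g);
  tensm_linear_l : forall X X' Y Y' (g : hom Y Y') (a : k) (u v : hom X X'),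
    tensm (a *: u + v) g = a *: tensm u g + tensm v g;
  tensm_linear_r : forall X X' Y Y' (f : hom X X') (a : k) (u v : hom Y Y'),
    tensm f (a *: u + v) = a *: tensm f u + tensm f v;

  assoc : forall X Y Z, hom (tens (tens X Y) Z) (tens X (tens Y Z));
  assocV : forall X Y Z, hom (tens X (tens Y Z)) (tens (tens X Y) Z);
  assocK : forall X Y Z, comp (assocV X Y Z) (assoc X Y Z) = idm _;
  assocVK : forall X Y Z, comp (assoc X Y Z) (assocV X Y Z) = idm _;
  assoc_nat : forall X X' Y Y' Z Z' (f : hom X X') (g : hom Y Y') (h : hom Z Z'),
    comp (assoc X' Y' Z') (tensm (tensm f g) h) =
    comp (tensm f (tensm g h)) (assoc X Y Z);

  lunit : forall X, hom (tens unit_ob X) X;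
  lunitV : forall X, hom X (tens unit_ob X);
  lunitK : forall X, comp (lunitV X) (lunit X) = idm _;
  lunitVK : forall X, comp (lunit X) (lunitV X) = idm _;
  lunit_nat : forall X Y (f : hom X Y),
    comp (lunit Y) (tensm (idm unit_ob) f) = comp f (lunit X);

  runit : forall X, hom (tens X unit_ob) X;
  runitV : forall X, hom X (tens X unit_ob);
  runitK : forall X, comp (runitV X) (runit X) = idm _;
  runitVK : forall X, comp (runit X) (runitV X) = idm _;
  runit_nat : forall X Y (f : hom X Y),
    comp (runit Y) (tensm f (idm unit_ob)) = comp f (runit X);

  pentagon : forall X Y Z W,
    comp (assoc X Y (tens Z W)) (assoc (tens X Y) Z W) =
    comp (tensm (idm X) (assoc Y Z W))
      (comp (assoc X (tens Y Z) W) (tensm (assoc X Y Z) (idm W)));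
  triangle : forall X Y,
    comp (tensm (idm X) (lunit Y)) (assoc X unit_ob Y) =
    tensm (runit X) (idm Y);
  lunit_runit : lunit unit_ob = runit unit_ob;

  braid : forall X Y, hom (tens X Y) (tens Y X);
  braid_nat : forall X X' Y Y' (f : hom X X') (g : hom Y Y'),
    comp (braid X' Y') (tensm f g) = comp (tensm g f) (braid X Y);
  braidK : forall X Y, comp (braid Y X) (braid X Y) = idm _;
  braid_unit : forall X, comp (lunit X) (braid X unit_ob) = runit X;
  hexagon : forall X Y Z,
    comp (assoc Y Z X) (comp (braid X (tens Y Z)) (assoc X Y Z)) =
    comp (tensm (idm Y) (braid X Z))
      (comp (assoc Y X Z) (tensm (braid X Y) (idm Z)))
}.

Arguments hom {_ _} _ _.
Arguments idm {_ _} _.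
Arguments comp {_ _ _ _ _} _ _.
Arguments unit_ob {_} _.
Arguments tens {_ _} _ _.
Arguments tensm {_ _ _ _ _ _} _ _.
Arguments assoc {_ _} _ _ _.
Arguments assocV {_ _} _ _ _.
Arguments lunit {_ _} _.
Arguments lunitV {_ _} _.
Arguments runit {_ _} _.
Arguments runitV {_ _} _.
Arguments braid {_ _} _ _.

Notation "g \c f" := (comp g f)
  (at level 45, right associativity) : tcat_scope.
Notation "X \ox Y" := (tens X Y)
  (at level 40, left associativity) : tcat_scope.
Notation "f \om g" := (tensm f g)
  (at level 40, left associativity) : tcat_scope.

Section TensorCategory.
Variables (k : fieldType) (T : tensor_category k).
Implicit Types X Y : T.
Local Notation One := (unit_ob T).

Definition karoubian : Prop :=
  forall X (e : hom X X), e \c e = e ->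
    exists Y (r : hom X Y) (s : hom Y X), r \c s = idm Y /\ s \c r = e.

Definition is_zero X : Prop := idm X = 0.

Definition is_iso X Y (f : hom X Y) : Prop :=
  exists g : hom Y X, g \c f = idm X /\ f \c g = idm Y.

(* A rigid object is one admitting a duality. *)
Record duality X := Duality {
  dual_ob : T;
  ev : hom (dual_ob \ox X) One;
  coev : hom One (X \ox dual_ob);
  zigzag1 : runit X \c (idm X \om ev) \c assoc X dual_ob X
              \c (coev \om idm X) \c lunitV X = idm X;
  zigzag2 : lunit dual_ob \c (ev \om idm dual_ob) \c assocV dual_ob X dual_ob
              \c (idm dual_ob \om coev) \c runitV dual_ob = idm dual_ob
}.

Definition adjoint X Y Z (D : duality Y) (p : hom (X \ox Y) Z) :
    hom X (Z \ox dual_ob D) :=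
  (p \om idm (dual_ob D)) \c assocV X Y (dual_ob D)
    \c (idm X \om coev D) \c runitV X.

Definition is_perfect X (D : duality X) (p : hom (X \ox X) One) : Prop :=
  is_iso (lunit (dual_ob D) \c adjoint D p).

Definition dimension X (D : duality X) : hom One One :=
  ev D \c braid X (dual_ob D) \c coev D.

Definition interchange (A B C D : T) :
    hom ((A \ox B) \ox (C \ox D)) ((A \ox C) \ox (B \ox D)) :=
  assocV A C (B \ox D)
    \c (idm A \om (assoc C B D \c (braid B C \om idm D) \c assocV B C D))
    \c assoc A B (C \ox D).

Record algebra_data := AlgebraData {
  alg_ob :> T;
  alg_unit : hom One alg_ob;
  alg_mul : hom (alg_ob \ox alg_ob) alg_ob
}.

Record is_algebra (A : algebra_data) : Prop := IsAlgebra {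
  alg_mulA : alg_mul A \c (alg_mul A \om idm A) =
             alg_mul A \c (idm A \om alg_mul A) \c assoc A A A;
  alg_mulC : alg_mul A \c braid A A = alg_mul A;
  alg_mul1 : alg_mul A \c (alg_unit A \om idm A) = lunit A
}.

Definition trace_map (A : algebra_data) (D : duality A) : hom A One :=
  ev D \c braid A (dual_ob D) \c adjoint D (alg_mul A).

Record etale_structure (A : algebra_data) := EtaleStructure {
  et_alg : is_algebra A;
  et_dual : duality A;
  et_perfect : is_perfect et_dual (trace_map et_dual \c alg_mul A)
}.

(* An etale algebra carries a chosen dual of its underlying object; duals    *)
(* being unique up to unique isomorphism, nothing depends on this choice.    *)
Record etale := Etale {
  et_data :> algebra_data;
  et_str :> etale_structure et_data
}.

Definition trace (A : etale) : hom A One := trace_map (et_dual A).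

Definition is_alg_hom (A B : algebra_data) (f : hom A B) : bool :=
  (f \c alg_unit A == alg_unit B) &&
  (f \c alg_mul A == alg_mul B \c (f \om f)).

Record alg_hom (A B : algebra_data) := AlgHom {
  ah_val :> hom A B;
  ah_prop : is_alg_hom ah_val
}.

Lemma alg_hom_inj (A B : algebra_data) (f g : alg_hom A B) :
  ah_val f = ah_val g -> f = g.
Proof.
case: f g => [f Hf] [g Hg] /= E; case: _ / E Hg => Hg.
by rewrite (bool_irrelevance Hf Hg).
Qed.

Lemma alg_id_subproof (A : algebra_data) : is_alg_hom (A := A) (B := A) (idm A).
Proof. by rewrite /is_alg_hom tensm1 !comp1l comp1r !eqxx. Qed.

Definition alg_id (A : algebra_data) : alg_hom A A := AlgHom (alg_id_subproof A).

Lemma alg_comp_subproof (A B C : algebra_data)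
    (g : alg_hom B C) (f : alg_hom A B) :
  is_alg_hom (A := A) (B := C) (g \c f).
Proof.
case: f g => [f /andP[/eqP f1 /eqP fM]] [g /andP[/eqP g1 /eqP gM]] /=.
apply/andP; split; apply/eqP; first by rewrite -compA f1 g1.
by rewrite -compA fM compA gM tensm_comp -compA.
Qed.

Definition alg_comp (A B C : algebra_data) (g : alg_hom B C) (f : alg_hom A B) :
  alg_hom A C := AlgHom (alg_comp_subproof g f).

Definition Et : category.
Proof.
refine (@Category etale (fun A B => alg_hom A B) (fun A => alg_id A)
          (fun A B C g f => alg_comp g f) _ _ _).
- by move=> A B C D h g f; apply: alg_hom_inj; rewrite /= compA.
- by move=> A B f; apply: alg_hom_inj; rewrite /= comp1l.
- by move=> A B f; apply: alg_hom_inj; rewrite /= comp1r.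
Defined.

Definition EtOp : category := opposite Et.

(* g is the dual f^v of f : <g b, a>_A = <b, f a>_B for the trace pairings.  *)
Definition is_trace_dual (A B : etale) (f : alg_hom A B) (g : hom B A) : Prop :=
  trace A \c alg_mul A \c (g \om idm A) = trace B \c alg_mul B \c (idm B \om f).

Definition has_gamma (A B : etale) (f : alg_hom A B) (c : k) : Prop :=
  exists g : hom B A, is_trace_dual f g /\ g \c alg_unit B = c *: alg_unit A.

Definition uniform (A B : etale) (f : alg_hom A B) : Prop :=
  ~ is_zero A /\ exists c : k, has_gamma f c.

Definition unit_algebra : algebra_data := AlgebraData (idm One) (lunit One).

Lemma runitV1 : runitV One = lunitV One.
Proof.
by rewrite -[LHS]comp1l -(lunitK One) lunit_runit -compA runitVK comp1r.
Qed.

Lemma unit_assoc :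
  (idm One \om lunit One) \c assoc One One One = lunit One \om idm One.
Proof. by rewrite triangle -lunit_runit. Qed.

Lemma unit_braid : braid One One = idm (One \ox One).
Proof.
rewrite -[LHS]comp1l -(lunitK One) -compA braid_unit -lunit_runit.
by rewrite lunitK.
Qed.

Lemma unit_assocV :
  assocV One One One \c (idm One \om lunitV One) = lunitV One \om idm One.
Proof.
have E : (lunitV One \om idm One) \c (lunit One \om idm One)
         = idm ((One \ox One) \ox One).
  by rewrite -tensm_comp lunitK comp1l tensm1.
rewrite -[LHS]comp1l -E -unit_assoc -!compA (compA (assoc _ _ _)) assocVK.
by rewrite comp1l -tensm_comp lunitVK comp1l tensm1 comp1r.
Qed.

Lemma unit_is_algebra : is_algebra unit_algebra.
Proof.
split=> /=; first by rewrite unit_assoc.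
  by rewrite unit_braid comp1r.
by rewrite tensm1 comp1r.
Qed.

Lemma unit_zigzag1 :
  runit One \c (idm One \om lunit One) \c assoc One One One
    \c (lunitV One \om idm One) \c lunitV One = idm One.
Proof.
rewrite (compA _ (assoc _ _ _)) unit_assoc (compA (_ \om _)) -tensm_comp.
by rewrite lunitVK comp1l tensm1 comp1l -lunit_runit lunitVK.
Qed.

Lemma unit_zigzag2 :
  lunit One \c (lunit One \om idm One) \c assocV One One One
    \c (idm One \om lunitV One) \c runitV One = idm One.
Proof.
rewrite (compA (assocV _ _ _)) unit_assocV (compA (_ \om _)) -tensm_comp.
by rewrite lunitVK comp1l tensm1 comp1l lunit_runit runitVK.
Qed.

Definition unit_duality : duality unit_algebra :=
  @Duality One One (lunit One) (lunitV One) unit_zigzag1 unit_zigzag2.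

Lemma unit_adjoint (f : hom One One) :
  adjoint unit_duality (f \c lunit One) = lunitV One \c f.
Proof.
rewrite /adjoint /= (compA (assocV _ _ _)) unit_assocV (compA (_ \om _)).
rewrite -tensm_comp -compA lunitVK comp1l comp1r runitV1.
rewrite -[LHS]comp1l -(lunitK One) -compA; congr (_ \c _).
by rewrite compA lunit_runit runit_nat -compA -lunit_runit lunitVK comp1r.
Qed.

Lemma unit_trace : trace_map unit_duality = idm One.
Proof.
rewrite /trace_map /= unit_braid comp1l.
by rewrite -(comp1l (lunit One)) unit_adjoint comp1l comp1r lunitVK.
Qed.

Lemma unit_perfect :
  is_perfect unit_duality (trace_map unit_duality \c alg_mul unit_algebra).
Proof.
rewrite /is_perfect unit_trace unit_adjoint comp1r /= lunitVK.
by exists (idm One); rewrite comp1l.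
Qed.

Definition unit_etale : etale :=
  Etale (EtaleStructure unit_is_algebra unit_perfect).

Lemma eta_subproof (A : etale) :
  is_alg_hom (A := unit_etale) (B := A) (alg_unit A).
Proof.
apply/andP; split; apply/eqP; rewrite /= ?comp1r //.
rewrite -lunit_nat -(alg_mul1 (et_alg A)) -compA -tensm_comp.
by rewrite comp1l comp1r.
Qed.

Definition eta (A : etale) : alg_hom unit_etale A := AlgHom (eta_subproof A).

(* The tensor product of two etale algebras, at the level of raw data; that  *)
(* it is etale is part of [lex_product] below.                               *)
Definition tensor_algebra (A B : algebra_data) : algebra_data :=
  @AlgebraData (A \ox B)
    ((alg_unit A \om alg_unit B) \c lunitV One)
    ((alg_mul A \om alg_mul B) \c interchange A B A B).

Record ordered_etale := OrderedEtale {
  oe_et :> etale;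
  oe_sq : @product_of EtOp oe_et oe_et;
  oe_ord : subobject (oe_sq : EtOp);
  oe_total : is_total_order oe_ord
}.

(* A^(2), with the maps x |-> x (x) 1 and x |-> 1 (x) x composed with        *)
(* A (x) A -> A^(2); in EtOp, these are the projections of A x A restricted  *)
(* to the subobject R_A.                                                     *)
Definition oe_two (A : ordered_etale) : etale := sub_ob (oe_ord A).

Definition oe_pi1 (A : ordered_etale) : alg_hom A (oe_two A) :=
  @ccomp EtOp _ _ _ (pr1 (oe_sq A)) (sub_map (oe_ord A)).

Definition oe_pi2 (A : ordered_etale) : alg_hom A (oe_two A) :=
  @ccomp EtOp _ _ _ (pr2 (oe_sq A)) (sub_map (oe_ord A)).

Definition delannic (A : ordered_etale) : Prop :=
  is_zero A \/
  (~ is_zero A /\ [/\ uniform (eta A), uniform (oe_pi1 A) & uniform (oe_pi2 A)]).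

Inductive delannic_index := type1 | type2 | type3 | type4.

Definition index_mul (i j : delannic_index) : delannic_index :=
  match i, j with
  | _, type2 => type2
  | _, type3 => type3
  | _, type4 => i
  | type1, type1 => type4
  | type2, type1 => type3
  | type3, type1 => type2
  | type4, type1 => type1
  end.

(* (dim A, gamma(pi_A^2), gamma(pi_A^1)) -- in this order *)
Definition type_values (i : delannic_index) : k * k * k :=
  match i with
  | type1 => (-1, -1, -1)
  | type2 => (0, -1, 0)
  | type3 => (0, 0, -1)
  | type4 => (1, 0, 0)
  end.

Definition delannic_of_type (A : ordered_etale) (i : delannic_index) : Prop :=
  delannic A /\
  ((is_zero A /\ (i = type2 \/ i = type3)) \/
   (~ is_zero A /\
    let: (d, c2, c1) := type_values i in
    [/\ dimension (et_dual A) = d *: idm One,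
        has_gamma (oe_pi2 A) c2 & has_gamma (oe_pi1 A) c1])).

(* The tensor product algebra A (x) B, as an etale algebra and as a product  *)
(* of A and B in EtOp, together with the lexicographic relation on it (not   *)
(* assumed to be a total order).  Up to isomorphism there is only one.       *)
Record lex_product (A B : ordered_etale) := LexProduct {
  lex_etale : etale_structure (tensor_algebra A B);
  lex_in1 : alg_hom A (Etale lex_etale);
  lex_in2 : alg_hom B (Etale lex_etale);
  lex_in1E : ah_val lex_in1 = (idm A \om alg_unit B) \c runitV A;
  lex_in2E : ah_val lex_in2 = (alg_unit A \om idm B) \c lunitV B;
  lex_univ : @is_product EtOp A B (Etale lex_etale) lex_in1 lex_in2;
  lex_prod := @ProductOf EtOp A B (Etale lex_etale) lex_in1 lex_in2 lex_univ;
  lex_sq : @product_of EtOp lex_prod lex_prod;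
  lex_ord : subobject (lex_sq : EtOp);
  lex_ordP : is_lexicographic (oe_ord A) (oe_ord B) lex_ord
}.

Definition lex_ordered (A B : ordered_etale) (L : lex_product A B)
    (tot : is_total_order (lex_ord L)) : ordered_etale :=
  @OrderedEtale (Etale (lex_etale L)) (lex_sq L) (lex_ord L) tot.

End TensorCategory.

Arguments type_values {_} _.

(* Main.v *)
(* An ordered etale algebra X is replaced by its valued relations: for points
   x, y of X with values in an etale algebra D, the idempotents [x < y] and
   [x = y] of Gamma(D).  A complemented subobject of an object of Et^op is the
   locus where an idempotent equals 1, and a total order amounts to the identity
   [x < y] + [x = y] + [y < x] = 1 with orthogonal summands, plus transitivity.
   The lexicographic order is then [x < x'] + [x = x'] [y < y'], and its axioms
   become identities between idempotents of a commutative ring.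

   Since f^v (eta_B) is the element of A representing tr_B o f under the trace
   pairing, gamma(f) = c means tr_B o f = c tr_A.  Traces are additive over the
   decomposition of the order relation and multiplicative over tensor products,
   so gamma(pi_(A (x) B)) = gamma(pi_A) dim B + gamma(pi_B), while dim is
   multiplicative; the multiplication table follows. *)

(* The definitions speak of algebra maps, universal properties and chosen duals, whereas the
   argument needs linear sections, pairings of points as functions, and a trace independent of
   choices. Traces: an etale structure is traded for a form with a copairing, a datum that passes by
   explicit formulas to tensor products, direct factors and biproducts; two such forms on one
   algebra agree, so a trace is computed by exhibiting any form. Coproducts: their universal
   property in Et^op gives no linear maps, so a product algebra is built on a biproduct in [T] and
   its idempotents are transported along the comparison isomorphism. Split idempotents serve to
   realize an idempotent section as an etale algebra; hence subobjects exist, and an identity of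
   idempotents may be tested on the points where one of them is 1. Zero: non-zero factors might have
   a zero tensor product; the product of the dimensions is then 0, which forces the product type to
   be 2 or 3, the types allowed for the zero algebra. *)
From HB Require Import structures.
From mathcomp Require Import all_boot all_algebra ring.
Require Import Defs.

Set Implicit Arguments.
Unset Strict Implicit.
Unset Printing Implicit Defensive.

Import GRing.Theory.
Local Open Scope ring_scope.
Local Open Scope tcat_scope.

(** * Coherence *)

(* A tensor expression [a] is let act on T by Z |-> X1 (x) (X2 (x) ... Z), and a
   morphism between two tensor expressions acts by a natural family [Phi f].
   This action is faithful and kills all the associators and unitors, so
   equations between composites can be proved after [strict_goal]. *)
Section Coherence.
Variables (k : fieldType) (T : tensor_category k).
Implicit Types X Y Z W : T.
Local Notation One := (unit_ob T).

Lemma comp_cat X Y Z (g : hom Y Z) (f : hom X Y) (h : hom X Z) :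
  g \c f = h -> forall W (r : hom W X), g \c f \c r = h \c r.
Proof. by move=> e W r; rewrite compA e. Qed.

Lemma comp_cat2 X Y Y' Z (g : hom Y Z) (f : hom X Y) (g' : hom Y' Z)
    (f' : hom X Y') :
  g \c f = g' \c f' -> forall W (r : hom W X), g \c f \c r = g' \c f' \c r.
Proof. by move=> e W r; rewrite !compA e. Qed.

Lemma comp_inj_iso_r X Y Z (f g : hom Y Z) (s : hom X Y) (r : hom Y X) :
  s \c r = idm Y -> f \c s = g \c s -> f = g.
Proof. by move=> e E; rewrite -(comp1r f) -(comp1r g) -e !compA E. Qed.

Lemma comp_inj_iso_l X Y Z (f g : hom X Y) (s : hom Y Z) (r : hom Z Y) :
  r \c s = idm Y -> s \c f = s \c g -> f = g.
Proof. by move=> e E; rewrite -(comp1l f) -(comp1l g) -e -!compA E. Qed.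

Definition wh X Y Z (f : hom Y Z) : hom (X \ox Y) (X \ox Z) := idm X \om f.

Lemma wh_comp X Y Z W (g : hom Z W) (f : hom Y Z) :
  wh X (g \c f) = wh X g \c wh X f.
Proof. by rewrite /wh -tensm_comp comp1l. Qed.

Lemma wh1 X Y : wh X (idm Y) = idm (X \ox Y).
Proof. exact: tensm1. Qed.

Lemma tensm_split X X' Y Y' (f : hom X X') (g : hom Y Y') :
  f \om g = (f \om idm Y') \c (idm X \om g).
Proof. by rewrite -tensm_comp comp1l comp1r. Qed.

Lemma tensm_exch X X' Y Y' (f : hom X X') (g : hom Y Y') :
  (f \om idm Y') \c (idm X \om g) = (idm X' \om g) \c (f \om idm Y).
Proof. by rewrite -!tensm_comp !comp1l !comp1r. Qed.

Lemma wh_One_inj X Y (f g : hom X Y) : wh One f = wh One g -> f = g.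
Proof.
move=> e; apply: (comp_inj_iso_r (lunitVK X)).
by rewrite -!lunit_nat; move: e; rewrite /wh => ->.
Qed.

(* Kelly's redundancy of one of Mac Lane's unit axioms. *)
Lemma lunit_tens X Y : lunit (X \ox Y) \c assoc One X Y = lunit X \om idm Y.
Proof.
apply: wh_One_inj.
have K : ((assoc One One X \om idm Y) \c (assocV One One X \om idm Y))
         = idm _ by rewrite -tensm_comp assocVK comp1l tensm1.
apply: (comp_inj_iso_r (s := assoc _ _ _) (assocVK _ _ _)).
apply: (comp_inj_iso_r K).
rewrite wh_comp -!compA /wh -pentagon compA triangle.
rewrite -(tensm1 X Y) -!assoc_nat compA -assoc_nat.
by rewrite -!compA -!tensm_comp !comp1l -triangle.
Qed.

(** The bracketing of a tensor product cannot be inspected inside [T], so it is kept as syntax,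
    which [act] then erases. *)
Inductive oexp := OV of ob T | O1 | OT of oexp & oexp.

Fixpoint oden (a : oexp) : T :=
  match a with OV X => X | O1 => One | OT a b => oden a \ox oden b end.

Fixpoint act (a : oexp) Z : T :=
  match a with OV X => X \ox Z | O1 => Z | OT a b => act a (act b Z) end.

Fixpoint actm (a : oexp) Z Z' : hom Z Z' -> hom (act a Z) (act a Z') :=
  match a with
  | OV X => @wh X Z Z'
  | O1 => id
  | OT a b => fun f => actm a (actm b f)
  end.

(** The canonical rebracketing isomorphism from the actual tensor product to the strict action;
    conjugation by it turns [f \om idm Z] into [Phi f Z]. *)
Fixpoint flat (a : oexp) Z : hom (oden a \ox Z) (act a Z) :=
  match a with
  | OV X => idm _
  | O1 => lunit Z
  | OT a b => flat a (act b Z) \c wh (oden a) (flat b Z) \c assoc _ _ _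
  end.

Fixpoint flatV (a : oexp) Z : hom (act a Z) (oden a \ox Z) :=
  match a with
  | OV X => idm _
  | O1 => lunitV Z
  | OT a b => assocV _ _ _ \c wh (oden a) (flatV b Z) \c flatV a (act b Z)
  end.

Lemma actm1 a Z : actm a (idm Z) = idm _.
Proof.
by elim: a Z => [X|//|a IHa b IHb] Z /=; rewrite ?wh1 // IHb IHa.
Qed.

Lemma actm_comp a Z Z' Z'' (g : hom Z' Z'') (f : hom Z Z') :
  actm a (g \c f) = actm a g \c actm a f.
Proof.
elim: a Z Z' Z'' g f => [X|//|a IHa b IHb] Z Z' Z'' g f /=.
  exact: wh_comp.
by rewrite IHb IHa.
Qed.

Lemma flatK a Z : flatV a Z \c flat a Z = idm _.
Proof.
elim: a Z => [X|//|a IHa b IHb] Z /=; first by rewrite comp1l.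
  exact: lunitK.
rewrite -!compA (comp_cat (IHa _)) comp1l (compA (wh _ _)) -wh_comp IHb wh1.
by rewrite comp1l assocK.
Qed.

Lemma flatVK a Z : flat a Z \c flatV a Z = idm _.
Proof.
elim: a Z => [X|//|a IHa b IHb] Z /=; first by rewrite comp1l.
  exact: lunitVK.
rewrite -!compA (comp_cat (assocVK _ _ _)) comp1l (compA (wh _ _)) -wh_comp IHb.
by rewrite wh1 comp1l IHa.
Qed.

Lemma flat_nat a Z Z' (f : hom Z Z') :
  actm a f \c flat a Z = flat a Z' \c wh (oden a) f.
Proof.
elim: a Z Z' f => [X|//|a IHa b IHb] Z Z' f /=.
- by rewrite comp1l comp1r.
- by rewrite /wh lunit_nat.
rewrite compA IHa -!compA; congr (_ \c _).
by rewrite /wh -(tensm1 (oden a) (oden b)) assoc_nat !compA -!/(wh _ _) -!wh_comp IHb.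
Qed.

(* Locked: as it unfolds to a composite, rewriting with [-compA] would
   otherwise break it apart. *)
Definition Phi (a b : oexp) (f : hom (oden a) (oden b)) Z :
    hom (act a Z) (act b Z) :=
  locked (flat b Z \c (f \om idm Z) \c flatV a Z).

Lemma PhiE a b (f : hom (oden a) (oden b)) Z :
  Phi f Z \c flat a Z = flat b Z \c (f \om idm Z).
Proof. by rewrite /Phi -lock -!compA flatK comp1r. Qed.

Lemma Phi_unique a b (f : hom (oden a) (oden b)) Z g :
  g \c flat a Z = flat b Z \c (f \om idm Z) -> Phi f Z = g.
Proof. by rewrite -PhiE => /(comp_inj_iso_r (flatVK _ _)). Qed.

(** Tensoring with the unit loses nothing, since [runit] is a natural isomorphism; hence one value
    of [Z] suffices for faithfulness. *)
Lemma Phi_inj a b (f g : hom (oden a) (oden b)) :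
  Phi f One = Phi g One -> f = g.
Proof.
move=> e; have : (f \om idm One) = (g \om idm One).
  by apply: (comp_inj_iso_l (flatK _ _)); rewrite -!PhiE e.
move=> E; apply: (comp_inj_iso_r (runitVK _)).
by rewrite -!runit_nat E.
Qed.

(** Strict form of the interchange law: what acts on the left strands commutes with what acts
    further right. Many diagram moves below are instances of it. *)
Lemma Phi_nat a b (f : hom (oden a) (oden b)) Z Z' (g : hom Z Z') :
  Phi f Z' \c actm a g = actm b g \c Phi f Z.
Proof.
apply: (comp_inj_iso_r (flatVK _ _)).
rewrite -!compA flat_nat PhiE (comp_cat2 (PhiE _ _)) (comp_cat2 (flat_nat _ _)).
by rewrite /wh tensm_exch.
Qed.

Lemma Phi1 a Z : Phi (idm (oden a)) Z = idm _.
Proof. by rewrite /Phi -lock tensm1 comp1l flatVK. Qed.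

Lemma Phi_comp a b c (g : hom (oden b) (oden c)) (f : hom (oden a) (oden b)) Z :
  Phi (g \c f) Z = Phi g Z \c Phi f Z.
Proof.
apply: Phi_unique; rewrite -compA PhiE compA PhiE -compA -tensm_comp.
by rewrite comp1l.
Qed.

Lemma Phi_tens a a' b b' (f : hom (oden a) (oden a'))
    (g : hom (oden b) (oden b')) Z :
  Phi (a := OT a b) (b := OT a' b') (f \om g) Z =
  Phi f (act b' Z) \c actm a (Phi g Z).
Proof.
apply: Phi_unique => /=.
rewrite -!compA (comp_cat2 (flat_nat _ _)) (comp_cat2 (PhiE _ _)).
congr (_ \c _); rewrite assoc_nat (comp_cat (esym (wh_comp _ _ _))).
rewrite PhiE wh_comp -!compA /wh (comp_cat2 (tensm_exch _ _)); congr (_ \c _).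
by rewrite !compA -tensm_comp comp1r comp1l.
Qed.

(** The pentagon is exactly the agreement of the two ways of flattening. *)
Lemma Phi_assoc a b c Z :
  Phi (a := OT (OT a b) c) (b := OT a (OT b c)) (assoc _ _ _) Z = idm _.
Proof.
apply: Phi_unique => /=; rewrite comp1l !wh_comp -!compA; congr (_ \c _).
rewrite -pentagon; congr (_ \c _).
by rewrite /wh -(tensm1 (oden a)) (comp_cat2 (assoc_nat _ _ _)).
Qed.

Lemma Phi_lunit a Z : Phi (a := OT O1 a) (b := a) (lunit _) Z = idm _.
Proof.
apply: Phi_unique => /=; rewrite comp1l -lunit_tens compA lunit_nat.
by rewrite -compA.
Qed.

Lemma Phi_runit a Z : Phi (a := OT a O1) (b := a) (runit _) Z = idm _.
Proof. by apply: Phi_unique => /=; rewrite comp1l triangle. Qed.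

Lemma Phi_iso a b (f : hom (oden a) (oden b)) g Z fz gz :
  Phi f Z = fz -> f \c g = idm _ -> gz \c fz = idm _ -> Phi g Z = gz.
Proof.
move=> <- e E; rewrite -[LHS]comp1l -E -compA -Phi_comp e Phi1.
by rewrite comp1r.
Qed.

Lemma Phi_assocV a b c Z :
  Phi (a := OT a (OT b c)) (b := OT (OT a b) c) (assocV _ _ _) Z = idm _.
Proof. exact: (Phi_iso (Phi_assoc a b c Z) (assocVK _ _ _) (comp1l _)). Qed.

Lemma Phi_lunitV a Z : Phi (a := a) (b := OT O1 a) (lunitV _) Z = idm _.
Proof. exact: (Phi_iso (Phi_lunit a Z) (lunitVK _) (comp1l _)). Qed.

Lemma Phi_runitV a Z : Phi (a := a) (b := OT a O1) (runitV _) Z = idm _.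
Proof. exact: (Phi_iso (Phi_runit a Z) (runitVK _) (comp1l _)). Qed.

(** The only structural morphism that survives: the switch of two atomic strands. [braid1] and
    [sbraid] compose such switches to move a strand, then a whole expression, across another. *)
Definition bz X Y Z : hom (X \ox (Y \ox Z)) (Y \ox (X \ox Z)) :=
  Phi (a := OT (OV X) (OV Y)) (b := OT (OV Y) (OV X)) (braid X Y) Z.

Fixpoint braid1 X (b : oexp) Z : hom (X \ox act b Z) (act b (X \ox Z)) :=
  match b with
  | OV Y => bz X Y Z
  | O1 => idm _
  | OT b c => actm b (braid1 X c Z) \c braid1 X b (act c Z)
  end.

Fixpoint sbraid (a b : oexp) Z : hom (act a (act b Z)) (act b (act a Z)) :=
  match a with
  | OV X => braid1 X b Z
  | O1 => idm _
  | OT a c => sbraid a b (act c Z) \c actm a (sbraid c b Z)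
  end.

Local Notation Phib a b :=
  (Phi (a := OT a b) (b := OT b a) (braid (oden a) (oden b))).

Lemma Phi_braidK a b Z : Phib a b Z \c Phib b a Z = idm _.
Proof. by rewrite -Phi_comp braidK (Phi1 (OT _ _)). Qed.

Lemma Phi_braid1r a Z : Phib a O1 Z = idm _.
Proof.
rewrite -(Phi_runit a) -(braid_unit (oden a)).
by rewrite (Phi_comp (a := OT a O1) (b := OT O1 a)) Phi_lunit comp1l.
Qed.

Lemma Phi_braidTr a b c Z :
  Phib a (OT b c) Z = actm b (Phib a c Z) \c Phib a b (act c Z).
Proof.
have /(congr1 (fun f => Phi (a := OT (OT a b) c) (b := OT b (OT c a)) f Z)) :=
  hexagon (oden a) (oden b) (oden c).
rewrite !(Phi_comp (b := OT (OT b c) a)) !(Phi_comp (b := OT a (OT b c))).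
rewrite !(Phi_comp (b := OT b (OT a c))) !(Phi_comp (b := OT (OT b a) c)).
rewrite !Phi_assoc !comp1l /= !comp1r => ->.
rewrite (Phi_tens (a := b) (a' := b) (b := OT a c) (b' := OT c a)).
rewrite (Phi_tens (a := OT a b) (a' := OT b a) (b := c) (b' := c)).
by rewrite !Phi1 !comp1l actm1 comp1r.
Qed.

(** The hexagon decomposes the braiding in its right argument. The left-hand version is not an axiom
    and is obtained from the symmetry, each braiding being inverse to the opposite one. *)
Lemma Phi_braid a b Z : Phib a b Z = sbraid a b Z.
Proof.
elim: a Z => [X|/=|a IHa c IHc] Z /=.
- elim: b Z => [Y|/=|b IHb c IHc] Z /=; first by [].
    exact: (Phi_braid1r (OV X)).
  by rewrite (Phi_braidTr (OV X)) IHb IHc.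
- have := Phi_braidK O1 b Z; rewrite Phi_braid1r => <-.
  by rewrite comp1r.
- rewrite -IHa -IHc.
  have E := Phi_braidTr b a c Z.
  rewrite -[LHS]comp1r.
  have : Phib b (OT a c) Z \c Phib a b (act c Z) \c actm a (Phib c b Z) = idm _.
    rewrite E -compA (comp_cat (Phi_braidK b a _)) comp1l -actm_comp.
    by rewrite Phi_braidK actm1.
  by move=> <-; rewrite (comp_cat (Phi_braidK (OT a c) b Z)) comp1l.
Qed.

Inductive mexp : oexp -> oexp -> Type :=
| MG a b of hom (oden a) (oden b) : mexp a b
| MI a : mexp a a
| MC a b c of mexp b c & mexp a b : mexp a c
| MT a a' b b' of mexp a a' & mexp b b' : mexp (OT a b) (OT a' b')
| MA a b c : mexp (OT (OT a b) c) (OT a (OT b c))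
| MAV a b c : mexp (OT a (OT b c)) (OT (OT a b) c)
| ML a : mexp (OT O1 a) a
| MLV a : mexp a (OT O1 a)
| MR a : mexp (OT a O1) a
| MRV a : mexp a (OT a O1)
| MB a b : mexp (OT a b) (OT b a).

Fixpoint mden a b (m : mexp a b) : hom (oden a) (oden b) :=
  match m with
  | MG _ _ f => f
  | MI _ => idm _
  | MC _ _ _ g f => mden g \c mden f
  | MT _ _ _ _ f g => mden f \om mden g
  | MA _ _ _ => assoc _ _ _
  | MAV _ _ _ => assocV _ _ _
  | ML _ => lunit _
  | MLV _ => lunitV _
  | MR _ => runit _
  | MRV _ => runitV _
  | MB _ _ => braid _ _
  end.

Fixpoint sev a b (m : mexp a b) Z : hom (act a Z) (act b Z) :=
  match m with
  | MG _ _ f => Phi f Z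
  | MI _ => idm _
  | MC _ _ _ g f => sev g Z \c sev f Z
  | MT a a' b b' f g => sev f (act b' Z) \c actm a (sev g Z)
  | MA _ _ _ => idm _
  | MAV _ _ _ => idm _
  | ML _ => idm _
  | MLV _ => idm _
  | MR _ => idm _
  | MRV _ => idm _
  | MB a b => sbraid a b Z
  end.

Lemma sevE a b (m : mexp a b) Z : Phi (mden m) Z = sev m Z.
Proof.
elim: m Z => {a b} /=.
- by [].
- exact: Phi1.
- by move=> a b c g IHg f IHf Z; rewrite Phi_comp IHg IHf.
- by move=> a a' b b' f IHf g IHg Z; rewrite Phi_tens IHg IHf.
- exact: Phi_assoc.
- exact: Phi_assocV.
- exact: Phi_lunit.
- exact: Phi_lunitV.
- exact: Phi_runit.
- exact: Phi_runitV.
- exact: Phi_braid.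
Qed.

Lemma strict_goal a b (m m' : mexp a b) :
  (forall Z, sev m Z = sev m' Z) -> mden m = mden m'.
Proof. by move=> e; apply: Phi_inj; rewrite !sevE. Qed.

Lemma strict_hyp a b (m m' : mexp a b) :
  mden m = mden m' -> forall Z, sev m Z = sev m' Z.
Proof. by move=> e Z; rewrite -!sevE e. Qed.

End Coherence.

(** * Frobenius structures *)

Ltac reify_ob X :=
  lazymatch X with
  | @tens ?k ?T ?Y ?Z =>
    let y := reify_ob Y in let z := reify_ob Z in constr:(@OT k T y z)
  | @unit_ob ?k ?T => constr:(@O1 k T)
  | _ => constr:(OV X)
  end.

Ltac reify_hom f :=
  lazymatch f with
  | comp ?g ?h =>
    let g' := reify_hom g in let h' := reify_hom h in constr:(MC g' h')
  | tensm ?g ?h =>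
    let g' := reify_hom g in let h' := reify_hom h in constr:(MT g' h')
  | idm ?X => let x := reify_ob X in constr:(MI x)
  | assoc ?X ?Y ?Z =>
    let x := reify_ob X in let y := reify_ob Y in let z := reify_ob Z in
    constr:(MA x y z)
  | assocV ?X ?Y ?Z =>
    let x := reify_ob X in let y := reify_ob Y in let z := reify_ob Z in
    constr:(MAV x y z)
  | lunit ?X => let x := reify_ob X in constr:(ML x)
  | lunitV ?X => let x := reify_ob X in constr:(MLV x)
  | runit ?X => let x := reify_ob X in constr:(MR x)
  | runitV ?X => let x := reify_ob X in constr:(MRV x)
  | braid ?X ?Y =>
    let x := reify_ob X in let y := reify_ob Y in constr:(MB x y)
  | _ =>
    let ty := type of f in
    (* The type of a morphism is the carrier of the module [hom X Y], so the endpoints are searched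
       for inside it, not matched at its head. *)
    lazymatch ty with
    | context [@hom _ _ ?X ?Y] =>
      let x := reify_ob X in let y := reify_ob Y in
      constr:(@MG _ _ x y f)
    end
  end.

Ltac strict_simpl := rewrite ?(comp1l, comp1r, wh1, wh_comp) -?compA.

Ltac strict :=
  lazymatch goal with
  | |- ?f = ?g =>
    let f' := reify_hom f in let g' := reify_hom g in
    change (mden f' = mden g'); apply: strict_goal => Z;
    cbn [sev act actm sbraid braid1]; strict_simpl
  end.

Ltac strictify H :=
  lazymatch type of H with
  | ?f = ?g =>
    let f' := reify_hom f in let g' := reify_hom g in
    move: (strict_hyp (H : mden f' = mden g'));
    cbn [sev act actm sbraid braid1]
  end.

(** * String diagrams for commutative algebras, and the comparison of etale structures with forms *)

Section Algebra.
Variables (k : fieldType) (T : tensor_category k).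
Implicit Types X Y Z W : T.
Local Notation One := (unit_ob T).

Lemma wh_cat X Y Z W (g : hom Z W) (f : hom Y Z) h :
  g \c f = h -> wh X g \c wh X f = wh X h.
Proof. by move=> <-; rewrite wh_comp. Qed.

Lemma wh_cat2 X Y Z Z' W (g : hom Z W) (f : hom Y Z) (g' : hom Z' W) f' :
  g \c f = g' \c f' -> wh X g \c wh X f = wh X g' \c wh X f'.
Proof. by rewrite -!wh_comp => ->. Qed.

Lemma bz_nat X Y Z Z' (f : hom Z Z') :
  bz X Y Z' \c wh X (wh Y f) = wh Y (wh X f) \c bz X Y Z.
Proof. exact: (Phi_nat (a := OT (OV X) (OV Y)) (b := OT (OV Y) (OV X))). Qed.

Lemma bzK X Y Z : bz X Y Z \c bz Y X Z = idm _.
Proof. exact: (Phi_braidK (OV X) (OV Y)). Qed.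

(** Naturality of the braiding in strict form: a generator is dragged across the strand [Y]. The
    rules [bz_sm_l], [bz_su_l], [bz_sc_l] are instances. *)
Lemma braid_Phi_l (a b : oexp T) (f : hom (oden a) (oden b)) Y Z :
  sbraid b (OV Y) Z \c Phi f (Y \ox Z) = wh Y (Phi f Z) \c sbraid a (OV Y) Z.
Proof.
have E : mden (MC (MB b (OV Y)) (MT (MG f) (MI (OV Y)))) =
         mden (MC (MT (MI (OV Y)) (MG f)) (MB a (OV Y))) by exact: braid_nat.
by have /= := strict_hyp E Z; rewrite ?wh1 (actm1 a) !(comp1r, comp1l).
Qed.

Lemma braid_Phi_r (a b : oexp T) (f : hom (oden a) (oden b)) Y Z :
  sbraid (OV Y) b Z \c wh Y (Phi f Z) = Phi f (Y \ox Z) \c sbraid (OV Y) a Z.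
Proof.
have E : mden (MC (MB (OV Y) b) (MT (MI (OV Y)) (MG f))) =
         mden (MC (MT (MG f) (MI (OV Y))) (MB (OV Y) a)) by exact: braid_nat.
by have /= := strict_hyp E Z; rewrite ?wh1 (actm1 a) !(comp1r, comp1l).
Qed.

Lemma comp_cat3 X Y Z W (h : hom Z W) (g : hom Y Z) (f : hom X Y) e :
  h \c g \c f = e -> forall V (r : hom V X), h \c g \c f \c r = e \c r.
Proof. by move=> <- V r; rewrite !compA. Qed.

Lemma comp_cat32 X Y Z Y' W (h : hom Z W) (g : hom Y Z) (f : hom X Y)
    (g' : hom Y' W) (f' : hom X Y') :
  h \c g \c f = g' \c f' ->
  forall V (r : hom V X), h \c g \c f \c r = g' \c f' \c r.
Proof. by move=> e V r; have := congr1 (fun u => u \c r) e; rewrite -!compA. Qed.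

Section Generators.
Variable A : algebra_data T.

(** Generators of the diagram calculus. Multiplication and unit, and later form and copairing, act
    on the leftmost strands; [Z] collects the strands to their right. *)
Definition sm Z : hom (A \ox (A \ox Z)) (A \ox Z) :=
  Phi (a := OT (OV (alg_ob A)) (OV (alg_ob A))) (b := OV (alg_ob A)) (alg_mul A) Z.
Definition su Z : hom Z (A \ox Z) :=
  Phi (a := O1 T) (b := OV (alg_ob A)) (alg_unit A) Z.

Lemma sm_nat Z Z' (f : hom Z Z') : sm Z' \c wh A (wh A f) = wh A f \c sm Z.
Proof. exact: (Phi_nat (a := OT (OV _) (OV _)) (b := OV _)). Qed.
Lemma su_nat Z Z' (f : hom Z Z') : su Z' \c f = wh A f \c su Z.
Proof. exact: (Phi_nat (a := O1 T) (b := OV _)). Qed.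

Lemma bz_sm_l Y Z :
  bz A Y Z \c sm (Y \ox Z) = wh Y (sm Z) \c bz A Y (A \ox Z) \c wh A (bz A Y Z).
Proof. exact: (braid_Phi_l (a := OT (OV _) (OV _)) (b := OV _)). Qed.
Lemma bz_sm_r Y Z :
  bz Y A Z \c wh Y (sm Z) = sm (Y \ox Z) \c wh A (bz Y A Z) \c bz Y A (A \ox Z).
Proof. exact: (braid_Phi_r (a := OT (OV _) (OV _)) (b := OV _)). Qed.
Lemma bz_su_l Y Z : bz A Y Z \c su (Y \ox Z) = wh Y (su Z).
Proof. by rewrite -[RHS]comp1r; exact: (braid_Phi_l (a := O1 T) (b := OV _)). Qed.
Lemma bz_su_r Y Z : bz Y A Z \c wh Y (su Z) = su (Y \ox Z).
Proof. by rewrite -[RHS]comp1r; exact: (braid_Phi_r (a := O1 T) (b := OV _)). Qed.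

Hypothesis HA : is_algebra A.

Lemma smA Z : sm Z \c sm (A \ox Z) = sm Z \c wh A (sm Z).
Proof.
have H := alg_mulA HA; strictify H => /(_ Z).
by strict_simpl.
Qed.

Lemma smC Z : sm Z \c bz A A Z = sm Z.
Proof. by have H := alg_mulC HA; strictify H => /(_ Z). Qed.

Lemma sm1 Z : sm Z \c su (A \ox Z) = idm _.
Proof. by have H := alg_mul1 HA; strictify H => /(_ Z); strict_simpl. Qed.

Lemma sm1r Z : sm Z \c wh A (su Z) = idm _.
Proof. by rewrite -smC -compA bz_su_r sm1. Qed.

(* An algebra is etale precisely when it carries a form t such that t o m is a
   perfect pairing with copairing c satisfying m o c = 1; then t is the trace and
   c is the separability idempotent. *)
Record frobenius (t : hom A One) (c : hom One (A \ox A)) : Prop := Frobenius {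
  frob_zigzag : lunit A \c ((t \c alg_mul A) \om idm A) \c assocV A A A
                  \c (idm A \om c) \c runitV A = idm A;
  frob_special : alg_mul A \c c = alg_unit A
}.

Definition st (t : hom A One) Z : hom (A \ox Z) Z :=
  Phi (a := OV (alg_ob A)) (b := O1 T) t Z.
Definition sc (c : hom One (A \ox A)) Z : hom Z (A \ox (A \ox Z)) :=
  Phi (a := O1 T) (b := OT (OV (alg_ob A)) (OV (alg_ob A))) c Z.

Lemma st_nat t Z Z' (f : hom Z Z') : st t Z' \c wh A f = f \c st t Z.
Proof. exact: (Phi_nat (a := OV _) (b := O1 T)). Qed.
Lemma sc_nat c Z Z' (f : hom Z Z') : sc c Z' \c f = wh A (wh A f) \c sc c Z.
Proof. exact: (Phi_nat (a := O1 T) (b := OT (OV _) (OV _))). Qed.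

Lemma bz_st_r t Y Z : wh Y (st t Z) = st t (Y \ox Z) \c bz Y A Z.
Proof. by rewrite -[LHS]comp1l; exact: (braid_Phi_r (a := OV _) (b := O1 T)). Qed.
Lemma bz_sc_l c Y Z :
  bz A Y (A \ox Z) \c wh A (bz A Y Z) \c sc c (Y \ox Z) = wh Y (sc c Z).
Proof.
rewrite -[RHS]comp1r compA.
exact: (braid_Phi_l (a := O1 T) (b := OT (OV _) (OV _))).
Qed.
Lemma bz_wh_sc c Y Z :
  bz Y A (A \ox Z) \c wh Y (sc c Z) = wh A (bz A Y Z) \c sc c (Y \ox Z).
Proof.
rewrite -[LHS]comp1l -wh1 -(bzK A Y Z) wh_comp -!compA; congr (_ \c _).
rewrite -[RHS]comp1r compA.
exact: (braid_Phi_r (a := O1 T) (b := OT (OV _) (OV _))).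
Qed.

Section Frobenius.
Variables (t : hom A One) (c : hom One (A \ox A)).
Hypothesis F : frobenius t c.

Lemma frob_zz Z : st t (A \ox Z) \c sm (A \ox Z) \c wh A (sc c Z) = idm _.
Proof.
have H := frob_zigzag F; strictify H => /(_ Z); strict_simpl.
by [].
Qed.

Lemma frob_mc Z : sm Z \c sc c Z = su Z.
Proof. by have H := frob_special F; strictify H => /(_ Z). Qed.

Lemma frob_pairC Z : (st t Z \c sm Z) \c bz A A Z = st t Z \c sm Z.
Proof. by rewrite -compA smC. Qed.

(** Only one snake identity is assumed. Let [l] be the other snake composite and p the pairing. The
    assumed identity gives p(x, l y) = p(x, y); as p is symmetric and, by the same identity,
    non-degenerate, [l] is the identity. *)
Lemma frob_zz_mirror Z :
  wh A (st t Z \c sm Z) \c sc c (A \ox Z) = idm _.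
Proof.
(* Introduced through an equation, so that reification treats the composite as one opaque
   generator. *)
have [L H] : exists L : hom A A, L = runit A \c (idm A \om (t \c alg_mul A))
  \c assoc A A A \c (c \om idm A) \c lunitV A by eexists.
strictify H => {}H.
have {H} LE W : wh A (st t W \c sm W) \c sc c (A \ox W) =
    Phi (a := OV (alg_ob A)) (b := OV (alg_ob A)) L W.
  by rewrite H; strict_simpl.
set l := Phi (a := OV (alg_ob A)) (b := OV (alg_ob A)) L in LE *.
have lbz Y W : bz Y A W \c wh Y (l W) = l (Y \ox W) \c bz Y A W.
  exact: (braid_Phi_r (a := OV _) (b := OV _)).
have pl W : st t W \c sm W \c wh A (l W) = st t W \c sm W.
  rewrite -LE [wh A (_ \c sc _ _)]wh_comp (comp_cat2 (sm_nat _)) (comp_cat2 (st_nat _ _)).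
  by rewrite frob_zz comp1r.
rewrite LE -[LHS]comp1l -(frob_zz Z) -[sm (A \ox Z)]smC -!compA.
rewrite (comp_cat2 (bz_wh_sc _ _ _)) sc_nat (comp_cat2 (wh_cat2 A (lbz _ _))).
by rewrite (comp_cat3 (pl _)) -!compA -bz_wh_sc (comp_cat (smC _)) frob_zz.
Qed.

Lemma frob_mirror :
  runit A \c (idm A \om (t \c alg_mul A)) \c assoc A A A \c (c \om idm A)
    \c lunitV A = idm A.
Proof.
strict; rewrite -[RHS]frob_zz_mirror wh_comp -!compA; congr (_ \c _).
Qed.

Definition frob_duality : duality A :=
  Duality frob_mirror (frob_zigzag F).

(** With c the sum of a_i (x) b_i, the trace of multiplication by x is the sum of the t(x a_i b_i),
    that is t(x m(c)), and m(c) = 1. *)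
Lemma frob_trace : trace_map frob_duality = t.
Proof.
rewrite /trace_map /adjoint /=; strict.
change (st t Z \c sm Z \c bz A A Z \c sm (A \ox Z) \c wh A (sc c Z) = st t Z).
rewrite (comp_cat (smC _)) (comp_cat2 (smA _)) -wh_comp frob_mc.
by rewrite sm1r comp1r.
Qed.

Lemma frob_perfect :
  is_perfect frob_duality (trace_map frob_duality \c alg_mul A).
Proof.
exists (idm A); rewrite frob_trace comp1l comp1r.
have : lunit A \c adjoint frob_duality (t \c alg_mul A) = idm A.
  exact: frob_zigzag F.
by move=> ->.
Qed.

Definition frob_etale : etale_structure A := EtaleStructure HA frob_perfect.

End Frobenius.

(** The copairing is the coevaluation transported along [psi], the inverse of the isomorphism [phi]
    given by perfectness. Since t is the trace, t(x m(c)) = t(x) for all x, and non-degeneracy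
    yields m(c) = 1. *)
Lemma etale_frob (E : etale_structure A) :
  exists c, frobenius (trace_map (et_dual E)) c.
Proof.
(* With the trace and [phi] hidden behind equations, the duality can be destructed. *)
have [t Ht] : exists t, t = trace_map (et_dual E) by eexists.
have [phi Hphi] : exists phi, phi = lunit (dual_ob (et_dual E))
  \c adjoint (et_dual E) (t \c alg_mul A) by eexists.
have := et_perfect E; rewrite /is_perfect -Ht -Hphi.
case: (et_dual E) t Ht phi Hphi => /= D ev cv z1 z2 t Ht phi Hphi.
move=> [psi [psiK phiK]].
rewrite /trace_map /adjoint /= in Ht Hphi.
pose sev Z := Phi (a := OT (OV D) (OV (alg_ob A))) (b := O1 T) ev Z.
pose scv Z := Phi (a := O1 T) (b := OT (OV (alg_ob A)) (OV D)) cv Z.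
pose sphi Z := Phi (a := OV (alg_ob A)) (b := OV D) phi Z.
pose spsi Z := Phi (a := OV D) (b := OV (alg_ob A)) psi Z.
pose c := (idm A \om psi) \c cv; exists c.
have scE Z : sc c Z = wh A (spsi Z) \c scv Z.
  have H : c = (idm A \om psi) \c cv by [].
  move: c H => c H; strictify H => /(_ Z); strict_simpl.
  exact id.
have spsiK Z : spsi Z \c sphi Z = idm _ by strictify psiK => /(_ Z).
have sphiK Z : sphi Z \c spsi Z = idm _ by strictify phiK => /(_ Z).
have sphiE Z : st t (D \ox Z) \c sm (D \ox Z) \c wh A (scv Z) = sphi Z.
  strictify Hphi => /(_ Z); strict_simpl.
  by move/esym.
have stE Z : st t Z = sev Z \c bz A D Z \c sm (D \ox Z) \c wh A (scv Z).
  strictify Ht => /(_ Z); strict_simpl.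
  by move/esym.
have szz Z : wh A (sev Z) \c scv (A \ox Z) = idm _.
  strictify z1 => /(_ Z); strict_simpl.
  by move/esym.
have bz_psi Z : bz A A Z \c wh A (spsi Z) = spsi (A \ox Z) \c bz A D Z.
  exact: (braid_Phi_r (a := OV _) (b := OV _)).
have zz Z : st t (A \ox Z) \c sm (A \ox Z) \c wh A (sc c Z) = idm _.
  rewrite scE wh_comp (comp_cat2 (sm_nat _)) (comp_cat2 (st_nat _ _)).
  by rewrite sphiE spsiK.
have sevE Z : sev Z = st t Z \c sm Z \c spsi (A \ox Z).
  rewrite -[LHS]comp1r -(sphiK (A \ox Z)) !compA; congr (_ \c _).
  rewrite -sphiE -(comp_cat2 (st_nat _ _)) -(comp_cat2 (sm_nat _)).
  by rewrite (wh_cat2 A (g' := idm _) (f' := idm _)) ?szz ?comp1l // wh1 !comp1r.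
have tE Z : st t Z = st t Z \c sm Z \c wh A (sm Z \c sc c Z).
  rewrite [LHS]stE sevE -!compA -(comp_cat2 (bz_psi _)) (comp_cat (smC _)).
  rewrite -(comp_cat2 (sm_nat _)) -wh_comp -scE (comp_cat2 (smA _)).
  by rewrite -wh_comp.
have mc Z : sm Z \c sc c Z = su Z.
  have xs W : st t W \c sm W \c sm (A \ox W) \c sc c (A \ox W) = st t W.
    rewrite [RHS]tE wh_comp -bz_sc_l (comp_cat32 (esym (bz_sm_l _ _))).
    by rewrite (comp_cat (smC _)).
  rewrite -[LHS]comp1l -(zz Z) -!compA -(comp_cat2 (sm_nat _)) -sc_nat.
  rewrite -[RHS]comp1l -(zz Z) -!compA -su_nat (comp_cat (sm1 _)) comp1l.
  by have := xs (A \ox Z); rewrite !compA => ->.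
split; strict; [exact: zz | exact: mc].
Qed.

(* Both forms compute the trace of the multiplication operators, expanded in the
   two pairs of dual bases given by c and c'. *)
Lemma frob_trace_unique t c t' c' : frobenius t c -> frobenius t' c' -> t = t'.
Proof.
move=> F F'; strict; rewrite -/(st t Z) -/(st t' Z).
have [p pE] : exists p : forall W, hom (A \ox (A \ox W)) W,
    forall W, p W = st t W \c sm W by eexists.
have pnat W W' (f : hom W W') : p W' \c wh A (wh A f) = f \c p W.
  by rewrite !pE -compA sm_nat (comp_cat2 (st_nat _ _)).
(* Let c be the sum of a_i (x) b_i and c' that of x_j (x) y_j. The terms a_i t(y_j b_i) (x) x_j sum
   to the y_j (x) x_j, so contraction with c along t returns c' switched. *)
have GE : wh A (wh A (p Z)) \c wh A (sc c' (A \ox Z)) \c sc c Z =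
    bz A A Z \c sc c' Z.
  have pbz : wh A (p Z) \c bz A A (A \ox Z) = p (A \ox Z) \c wh A (bz A A Z).
    rewrite !pE wh_comp bz_st_r -!compA (comp_cat2 (bz_sm_r _ _)) -!compA.
    by rewrite bzK comp1r.
  have pC : p Z = p Z \c bz A A Z by rewrite pE frob_pairC.
  rewrite pC !wh_comp -!compA.
  rewrite (comp_cat2 (wh_cat2 A (esym (bz_wh_sc _ _ _)))) -sc_nat.
  rewrite (comp_cat2 (wh_cat2 A pbz)) (comp_cat2 (esym (sc_nat _ _))).
  by rewrite pE (comp_cat (frob_zz_mirror F _)) comp1l.
(* Expanding x a_i in the bases of c' gives t(x) = t(x a_i b_i) = t'(x a_i x_j) t(y_j b_i), summed
   over i and j. *)
have -> : st t Z = st t' Z \c sm Z \c wh A (sm Z \c wh A (wh A (p Z)) \c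
    wh A (sc c' (A \ox Z)) \c sc c Z).
  rewrite !wh_comp -(comp_cat2 (smA _)) 2!(comp_cat2 (sm_nat _)).
  rewrite (comp_cat2 (st_nat _ _)) (comp_cat2 (sm_nat _)).
  rewrite (comp_cat3 (frob_zz F' _)) comp1l pE -compA (comp_cat2 (smA _)).
  by rewrite -wh_comp (frob_mc F) sm1r comp1r.
by rewrite GE (comp_cat (smC _)) (frob_mc F') sm1r comp1r.
Qed.

End Generators.
End Algebra.

(** * Bilinearity of composition and of the tensor product *)

Section Linear.
Variables (k : fieldType) (T : tensor_category k).
Implicit Types X Y Z : T.

Lemma comp_Dl X Y Z (u v : hom Y Z) (f : hom X Y) :
  (u + v) \c f = (u \c f) + (v \c f).
Proof. by rewrite -[u]scale1r comp_linear_l !scale1r. Qed.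
Lemma comp_0l X Y Z (f : hom X Y) : (0 : hom Y Z) \c f = 0.
Proof. by apply: (addrI (0 \c f)); rewrite -comp_Dl !addr0. Qed.
Lemma comp_Zl X Y Z a (u : hom Y Z) (f : hom X Y) :
  (a *: u) \c f = a *: (u \c f).
Proof. by rewrite -[a *: u]addr0 comp_linear_l comp_0l addr0. Qed.
Lemma comp_Dr X Y Z (f : hom Y Z) (u v : hom X Y) :
  f \c (u + v) = (f \c u) + (f \c v).
Proof. by rewrite -[u]scale1r comp_linear_r !scale1r. Qed.
Lemma comp_0r X Y Z (f : hom Y Z) : f \c (0 : hom X Y) = 0.
Proof. by apply: (addrI (f \c 0)); rewrite -comp_Dr !addr0. Qed.
Lemma comp_Zr X Y Z a (f : hom Y Z) (u : hom X Y) :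
  f \c (a *: u) = a *: (f \c u).
Proof. by rewrite -[a *: u]addr0 comp_linear_r comp_0r addr0. Qed.
Lemma tensm_Dl X X' Y Y' (g : hom Y Y') (u v : hom X X') :
  (u + v) \om g = (u \om g) + (v \om g).
Proof. by rewrite -[u]scale1r tensm_linear_l !scale1r. Qed.
Lemma tensm_0l X X' Y Y' (g : hom Y Y') : (0 : hom X X') \om g = 0.
Proof. by apply: (addrI (0 \om g)); rewrite -tensm_Dl !addr0. Qed.
Lemma tensm_Zl X X' Y Y' a (u : hom X X') (g : hom Y Y') :
  (a *: u) \om g = a *: (u \om g).
Proof. by rewrite -[a *: u]addr0 tensm_linear_l tensm_0l addr0. Qed.
Lemma tensm_Dr X X' Y Y' (g : hom Y Y') (u v : hom X X') :
  g \om (u + v) = (g \om u) + (g \om v).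
Proof. by rewrite -[u]scale1r tensm_linear_r !scale1r. Qed.
Lemma tensm_0r X X' Y Y' (g : hom Y Y') : g \om (0 : hom X X') = 0.
Proof. by apply: (addrI (g \om 0)); rewrite -tensm_Dr !addr0. Qed.
Lemma tensm_Zr X X' Y Y' a (u : hom X X') (g : hom Y Y') :
  g \om (a *: u) = a *: (g \om u).
Proof. by rewrite -[a *: u]addr0 tensm_linear_r tensm_0r addr0. Qed.
End Linear.

(** * Multiplication by a global section *)

Section Multiplication.
Variables (k : fieldType) (T : tensor_category k).
Implicit Types X Y Z : T.
Local Notation One := (unit_ob T).

Fact mu_key : unit. Proof. exact: tt. Qed.
(** Turns an idempotent section into an idempotent endomorphism, which can be split in [T]. Locked
    so that reassociation does not break it apart. *)
Definition mu (A : algebra_data T) (e : hom One A) : hom A A :=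
  locked_with mu_key (alg_mul A \c (e \om idm A) \c lunitV A).

Lemma muE (A : algebra_data T) (e : hom One A) :
  mu e = alg_mul A \c (e \om idm A) \c lunitV A.
Proof. by rewrite /mu unlock. Qed.

Lemma muD (A : algebra_data T) (e f : hom One A) : mu (e + f) = mu e + mu f.
Proof. by rewrite !muE tensm_Dl !(comp_Dl, comp_Dr). Qed.

Lemma lunitV_nat X Y (f : hom X Y) : lunitV Y \c f = (idm One \om f) \c lunitV X.
Proof.
rewrite -[RHS]comp1l -(lunitK Y) -!compA; congr (_ \c _).
by rewrite compA lunit_nat -compA lunitVK comp1r.
Qed.

Lemma mu_hom (A B : algebra_data T) (f : alg_hom A B) (e : hom One A) :
  f \c mu e = mu (f \c e) \c f.
Proof.
case: f => f /= /andP[_ /eqP fM]; rewrite !muE compA fM -!compA; congr (_ \c _).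
rewrite lunitV_nat compA -tensm_comp comp1r compA -tensm_comp comp1r.
by rewrite comp1l.
Qed.

Section MultiplicationBy.
Variable A : algebra_data T.
Hypothesis HA : is_algebra A.
Implicit Types e f : hom One A.

Lemma mu_mul_l e : alg_mul A \c (mu e \om idm A) = mu e \c alg_mul A.
Proof.
rewrite muE; strict.
change (sm A Z \c sm A (A \ox Z) \c Phi (a := O1 T) (b := OV (alg_ob A)) e
  (A \ox (A \ox Z)) = sm A Z \c Phi (a := O1 T) (b := OV (alg_ob A)) e (A \ox Z)
  \c sm A Z).
rewrite (comp_cat2 (smA HA _)); congr (_ \c _).
by rewrite (Phi_nat (a := O1 T) (b := OV (alg_ob A)) e (sm A Z)).
Qed.

Lemma mu_mul_r e : alg_mul A \c (idm A \om mu e) = mu e \c alg_mul A.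
Proof.
by rewrite -{1}(alg_mulC HA) -compA braid_nat compA mu_mul_l -compA alg_mulC.
Qed.

Lemma mu_unit e : mu e \c alg_unit A = e.
Proof.
rewrite muE; strict.
rewrite (Phi_nat (a := O1 T) (b := OV (alg_ob A)) e (su A Z)).
by rewrite (comp_cat (sm1r HA _)) comp1l.
Qed.

Lemma mu1 : mu (alg_unit A) = idm A.
Proof. by rewrite muE compA alg_mul1 // lunitVK. Qed.

Lemma mu_comp e f : mu e \c mu f = mu (mu e \c f).
Proof.
rewrite [mu f]muE [RHS]muE compA -mu_mul_l -compA (compA (_ \om _)) -tensm_comp.
by rewrite comp1l.
Qed.

Lemma mu_comm e f : mu e \c f = mu f \c e.
Proof.
rewrite !muE; strict.
set E := Phi (a := O1 T) (b := OV (alg_ob A)) e.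
set F := Phi (a := O1 T) (b := OV (alg_ob A)) f.
have -> : E (A \ox Z) \c F Z = wh A (F Z) \c E Z.
  exact: (Phi_nat (a := O1 T) (b := OV (alg_ob A)) e (F Z)).
rewrite -/(sm A Z) -[in LHS](smC HA) -!compA; congr (_ \c _).
have /= := braid_Phi_r (a := O1 T) (b := OV (alg_ob A)) f A Z.
by rewrite compA => ->; rewrite comp1r.
Qed.
End MultiplicationBy.
End Multiplication.

(** [strict] leaves raw [Phi] terms, while the rewriting rules are stated for the named
    generators. *)
Ltac fold_gen :=
  repeat match goal with
  | |- context [@Phi ?k ?T (OT (OV (alg_ob ?A)) (OV (alg_ob ?A))) (OV (alg_ob ?A)) (alg_mul ?A) ?Z] =>
    change (@Phi k T (OT (OV (alg_ob A)) (OV (alg_ob A))) (OV (alg_ob A)) (alg_mul A) Z) with (@sm k T A Z)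
  | |- context [@Phi ?k ?T (O1 _) (OV (alg_ob ?A)) (alg_unit ?A) ?Z] =>
    change (@Phi k T (O1 T) (OV (alg_ob A)) (alg_unit A) Z) with (@su k T A Z)
  | |- context [@Phi ?k ?T (OV (alg_ob ?A)) (O1 _) ?t ?Z] =>
    change (@Phi k T (OV (alg_ob A)) (O1 T) t Z) with (@st k T A t Z)
  | |- context [@Phi ?k ?T (O1 _) (OT (OV (alg_ob ?A)) (OV (alg_ob ?A))) ?c ?Z] =>
    change (@Phi k T (O1 T) (OT (OV (alg_ob A)) (OV (alg_ob A))) c Z) with (@sc k T A c Z)
  end.

(** * Tensor products of algebras *)

Section TensorAlgebra.
Variables (k : fieldType) (T : tensor_category k).
Implicit Types X Y Z : T.
Local Notation One := (unit_ob T).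

Lemma comp_cat4 X Y Z W W' (h : hom W W') (g : hom Z W) (f : hom Y Z)
    (e : hom X Y) d :
  h \c g \c f \c e = d ->
  forall V (r : hom V X), h \c g \c f \c e \c r = d \c r.
Proof. by move=> <- V r; rewrite !compA. Qed.

Section Two.
Variables A B : algebra_data T.
Hypotheses (HA : is_algebra A) (HB : is_algebra B).
Local Notation "A ◁ f" := (wh (alg_ob A) f) (at level 44, right associativity).

Lemma pair_braid t Y Z :
  (st (A := B) t (Y \ox Z) \c sm B (Y \ox Z)) \c wh B (bz Y B Z) \c
    bz Y B (B \ox Z) = wh Y (st t Z \c sm B Z).
Proof. by rewrite wh_comp bz_st_r -!compA -bz_sm_r. Qed.

(** Naturality moves the braidings aside until the strands of A and of B are separated; each axiom
    then reduces to that of A next to that of B. *)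
Lemma tensor_is_algebra : is_algebra (tensor_algebra A B).
Proof.
split; rewrite /= /interchange; strict; fold_gen.
- rewrite -!(comp_cat2 (sm_nat _ _)) (comp_cat2 (smA HA _)).
  rewrite (comp_cat2 (wh_cat2 A (wh_cat2 A (bz_sm_l _ _ _)))) !wh_comp -!compA.
  rewrite (comp_cat2 (wh_cat2 A (wh_cat2 A (wh_cat2 A (smA HB _))))).
  rewrite (comp_cat2 (wh_cat2 A (bz_sm_r _ _ _))) !wh_comp -!compA.
  rewrite -(comp_cat2 (wh_cat2 A (sm_nat _ _))).
  rewrite (comp_cat2 (wh_cat2 A (bz_nat _ _ _))).
  rewrite (comp_cat2 (wh_cat2 A (wh_cat2 A (bz_nat _ _ _)))).
  by rewrite (wh_cat2 A (bz_nat _ _ _)).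
- rewrite (comp_cat (wh_cat A (bzK _ _ _))) wh1 comp1l.
  rewrite -(comp_cat2 (bz_nat _ _ _)) (comp_cat (smC HA _)).
  by rewrite (comp_cat (wh_cat A (wh_cat A (smC HB _)))).
- rewrite -(comp_cat2 (su_nat _ _)) bz_su_l -(comp_cat2 (su_nat _ _)).
  by rewrite (comp_cat (sm1 HA _)) comp1l (wh_cat A (sm1 HB _)) wh1.
Qed.

Section Form.
Variables (tA : hom A One) (cA : hom One (A \ox A)).
Variables (tB : hom B One) (cB : hom One (B \ox B)).
Hypotheses (FA : frobenius tA cA) (FB : frobenius tB cB).

(** Gives at once that the tensor product is etale and that its trace is the product of the
    traces. *)
Lemma tensor_frobenius :
  frobenius (A := tensor_algebra A B) (lunit One \c (tA \om tB))
    (interchange A A B B \c (cA \om cB) \c lunitV One).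
Proof.
split; rewrite /= /interchange; strict; fold_gen.
- rewrite (comp_cat2 (wh_cat2 A (bz_nat _ _ _))).
  rewrite (comp_cat2 (wh_cat2 A (bz_wh_sc _ _ _))).
  rewrite -(comp_cat2 (sm_nat _ _)).
  have PB := pair_braid tB A (B \ox Z).
  have {}PB : A ◁ A ◁ st tB (A \ox (B \ox Z)) \c A ◁ A ◁ sm B (A \ox (B \ox Z))
    \c A ◁ A ◁ B ◁ bz A B (B \ox Z) \c A ◁ A ◁ bz A B (B \ox (B \ox Z))
    = A ◁ A ◁ A ◁ (st tB (B \ox Z) \c sm B (B \ox Z)).
    by rewrite -PB -!compA !wh_comp.
  rewrite (comp_cat4 PB) (comp_cat2 (wh_cat2 A (esym (sc_nat _ _)))).
  rewrite (comp_cat3 (frob_zz FA _)) comp1l wh_comp -compA -!wh_comp.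
  by rewrite (frob_zz FB) wh1.
- rewrite (comp_cat (wh_cat A (bzK _ _ _))) wh1 comp1l.
  rewrite -(comp_cat2 (sc_nat _ _)) (comp_cat (frob_mc FA _)).
  by rewrite (frob_mc FB).
Qed.
End Form.

Definition tensor_in1 : hom A (A \ox B) := (idm A \om alg_unit B) \c runitV A.
Definition tensor_in2 : hom B (A \ox B) := (alg_unit A \om idm B) \c lunitV B.

Lemma tensor_in1_subproof :
  is_alg_hom (A := A) (B := tensor_algebra A B) tensor_in1.
Proof.
rewrite /is_alg_hom /tensor_in1 /= /interchange; apply/andP; split; apply/eqP.
  by strict; fold_gen; rewrite su_nat.
strict; fold_gen; rewrite (comp_cat (wh_cat A (bz_su_l _ _ _))).
rewrite (comp_cat (wh_cat A (wh_cat A (sm1 HB _)))).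
by rewrite !wh1 comp1l sm_nat.
Qed.

Lemma tensor_in2_subproof :
  is_alg_hom (A := B) (B := tensor_algebra A B) tensor_in2.
Proof.
rewrite /is_alg_hom /tensor_in2 /= /interchange; apply/andP; split; apply/eqP.
  by strict; fold_gen; rewrite su_nat.
strict; fold_gen; rewrite -(comp_cat2 (su_nat _ _)) bz_su_r.
rewrite -(comp_cat2 (su_nat _ _)) (comp_cat (sm1 HA _)) comp1l.
by rewrite su_nat.
Qed.

(** As a (x) b = (a (x) 1)(1 (x) b), an algebra map out of the tensor product is determined by its
    two restrictions. *)
Lemma tensor_in_mul :
  alg_mul (tensor_algebra A B) \c (tensor_in1 \om tensor_in2) = idm (A \ox B).
Proof.
rewrite /tensor_in1 /tensor_in2 /= /interchange; strict; fold_gen.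
rewrite (comp_cat (wh_cat A (bz_su_l _ _ _))).
rewrite (comp_cat (wh_cat A (wh_cat A (sm1 HB _)))) !wh1 comp1l.
by rewrite (sm1r HA).
Qed.

Section Copairing.
Variables (C : algebra_data T) (HC : is_algebra C).

(** The two middle factors commute; this is what makes [copair] multiplicative. *)
Lemma mul_interchange :
  alg_mul C \c (alg_mul C \om alg_mul C) \c interchange C C C C =
  alg_mul C \c (alg_mul C \om alg_mul C).
Proof.
rewrite /interchange; strict; fold_gen.
have E W : sm C W \c wh C (sm C W) \c bz C C (C \ox W) = sm C W \c wh C (sm C W).
  by rewrite -(comp_cat2 (smA HC _)) (smC HC) (smA HC).
by rewrite !(comp_cat2 (smA HC _)) -!wh_comp E.
Qed.

Lemma assocV_nat X X' Y Y' Z Z' (f : hom X X') (g : hom Y Y') (h : hom Z Z') :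
  assocV X' Y' Z' \c (f \om (g \om h)) = ((f \om g) \om h) \c assocV X Y Z.
Proof.
apply: (comp_inj_iso_r (assocVK X Y Z)).
by rewrite -!compA assocK comp1r -assoc_nat compA assocK comp1l.
Qed.

Lemma interchange_nat (A' B' C' D A'' B'' C'' D' : T) (f : hom A' A'')
    (g : hom B' B'') (h : hom C' C'') (l : hom D D') :
  interchange A'' B'' C'' D' \c ((f \om g) \om (h \om l)) =
  ((f \om h) \om (g \om l)) \c interchange A' B' C' D.
Proof.
rewrite /interchange -!compA assoc_nat (compA (_ \om _) (_ \om _)) -tensm_comp.
rewrite -!compA comp1l assocV_nat (compA (_ \om idm _)) -tensm_comp comp1l.
rewrite braid_nat -{1}(comp1r l) tensm_comp -!compA.
rewrite (compA (assoc _ _ _)) assoc_nat -!compA -{1}(comp1r f) tensm_comp.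
by rewrite -compA (compA (assocV _ _ _)) assocV_nat -!compA.
Qed.

Lemma copair_subproof (f : alg_hom A C) (g : alg_hom B C) :
  is_alg_hom (A := tensor_algebra A B) (B := C) (alg_mul C \c (f \om g)).
Proof.
case: f g => f /andP[/eqP fu /eqP fM] [g /andP[/eqP gu /eqP gM]] /=.
apply/andP; split; apply/eqP; rewrite /=.
  rewrite -compA (compA (_ \om _)) -tensm_comp fu gu.
  by strict; fold_gen; rewrite (comp_cat (sm1 HC _)) comp1l.
rewrite -!compA (compA (_ \om _)) -tensm_comp fM gM !tensm_comp -!compA.
by rewrite -interchange_nat (comp_cat32 mul_interchange).
Qed.

Definition copair f g : alg_hom (tensor_algebra A B) C :=
  AlgHom (copair_subproof f g).

Lemma copair_in1 f g : copair f g \c tensor_in1 = f.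
Proof.
case: g => g /= /andP[/eqP gu _]; rewrite /tensor_in1 /=.
rewrite -compA (compA (_ \om _)) -tensm_comp comp1r gu; strict; fold_gen.
rewrite (Phi_nat (a := OV _) (b := OV _) f (su C Z)) /=.
by rewrite (comp_cat (sm1r HC _)) comp1l.
Qed.

Lemma copair_in2 f g : copair f g \c tensor_in2 = g.
Proof.
case: f => f /= /andP[/eqP fu _]; rewrite /tensor_in2 /=.
rewrite -compA (compA (_ \om _)) -tensm_comp comp1r fu; strict; fold_gen.
by rewrite (comp_cat (sm1 HC _)) comp1l.
Qed.

Lemma copair_unique (h : alg_hom (tensor_algebra A B) C) f g :
  h \c tensor_in1 = f -> h \c tensor_in2 = g -> h = alg_mul C \c (f \om g) :> hom _ _.
Proof.
move=> <- <-; case: h => h /= /andP[_ /eqP hM].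
rewrite tensm_comp compA /= in hM *.
by rewrite -hM -compA tensor_in_mul comp1r.
Qed.
End Copairing.

End Two.

End TensorAlgebra.

(** * The ring of global sections *)

Section GlobalSections.
Variables (k : fieldType) (T : tensor_category k).
Local Notation One := (unit_ob T).

(** An alias, so that the ring structure, which depends on the algebra and not just on its object,
    has a type to live on. For the zero algebra 1 = 0, hence a ring without the non-triviality
    axiom. *)
Definition gam (A : etale T) : Type := hom One A.

HB.instance Definition _ (A : etale T) :=
  GRing.Zmodule.copy (gam A) (hom One A).

Section Ring.
Variable A : etale T.
Let HA : is_algebra A := et_alg A.

Definition gmul (e f : gam A) : gam A := mu e \c f.
Definition gone : gam A := alg_unit A.

Lemma gmulA : associative gmul.
Proof. by move=> e f g; rewrite /gmul compA mu_comp. Qed.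
Lemma gmulC : commutative gmul.
Proof. by move=> e f; exact: mu_comm. Qed.
Lemma gmul1 : left_id gone gmul.
Proof. by move=> e; rewrite /gmul mu1 // comp1l. Qed.
Lemma gmulDl : left_distributive gmul +%R.
Proof. by move=> e f g; rewrite /gmul muD comp_Dl. Qed.

HB.instance Definition _ :=
  GRing.Zmodule_isComPzRing.Build (gam A) gmulA gmulC gmul1 gmulDl.
End Ring.

Definition gmap (A B : etale T) (f : alg_hom A B) (e : gam A) : gam B := f \c e.

Section Gmap.
Variables (A B : etale T) (f : alg_hom A B).

Lemma gmapM (x y : gam A) : gmap f (x * y) = gmap f x * gmap f y.
Proof. by rewrite /gmap [x * y]/(mu x \c y) compA mu_hom -compA. Qed.

Lemma gmap1 : gmap f 1 = 1.
Proof. by have /andP[/eqP + _] := ah_prop f. Qed.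

Lemma gmapD (x y : gam A) : gmap f (x + y) = gmap f x + gmap f y.
Proof. exact: comp_Dr. Qed.

Lemma gmap0 : gmap f 0 = 0.
Proof. exact: comp_0r. Qed.

End Gmap.

Lemma gmap_id (A : etale T) (x : gam A) : gmap (alg_id A) x = x.
Proof. exact: comp1l. Qed.

Lemma gmap_comp (A B C : etale T) (g : alg_hom B C) (f : alg_hom A B) x :
  gmap (alg_comp g f) x = gmap g (gmap f x).
Proof. by rewrite /gmap /= compA. Qed.

Lemma trace_frob (A : etale T) : exists c, frobenius (trace A) c.
Proof. exact: (etale_frob (et_alg A) A). Qed.

Lemma frob_traceE (A : etale T) t c : frobenius (A := A) t c -> t = trace A.
Proof.
by have [c' F'] := trace_frob A => F; apply: (frob_trace_unique (et_alg A) F F').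
Qed.

(** Multiplication by 1 is the identity, whose trace is the dimension. *)
Lemma dimension_trace (A : etale T) :
  dimension (et_dual A) = trace A \c alg_unit A.
Proof.
have HA := et_alg A.
rewrite /dimension /trace /trace_map /adjoint; case: (et_dual A) => D ev cv _ _ /=.
strict; fold_gen.
rewrite -(comp_cat2 (su_nat _ _)) || rewrite -su_nat.
by rewrite (comp_cat (sm1 HA _)) comp1l.
Qed.

Lemma has_gammaP (A B : etale T) (f : alg_hom A B) c :
  has_gamma f c <-> trace B \c f = c *: trace A.
Proof.
have HA := et_alg A; have HB := et_alg B.
have [ca FA] := trace_frob A; have [cb FB] := trace_frob B.
rewrite /has_gamma /is_trace_dual.
move: (trace A) (trace B) FA FB => tA tB FA FB; split.
  move=> [g [gd g1]].
  have := congr1 (fun u => u \c (alg_unit B \om idm A) \c lunitV A) gd.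
  rewrite -!compA (compA (_ \om _)) -tensm_comp g1 comp1l tensm_Zl.
  rewrite comp_Zl !comp_Zr (compA (alg_mul A)) alg_mul1 // lunitVK comp1r => ->.
  rewrite (compA (_ \om f)) -tensm_comp comp1l comp1r.
  rewrite tensm_split -compA -lunitV_nat (compA (alg_mul B)) alg_mul1 //.
  by rewrite (compA (lunit B)) lunitVK comp1l.
move=> E.
(* The dual map in dual bases: with [ca] the sum of a_i (x) b_i, it sends b to the sum of the [tB](b
   f(a_i)) b_i. *)
pose g := lunit A \c ((tB \c alg_mul B \c (idm B \om f)) \om idm A)
  \c assocV B A A \c (idm B \om ca) \c runitV B.
exists g; split.
  rewrite /g; strict; fold_gen.
  rewrite (compA (st tA Z)) -(comp_cat2 (st_nat _ _)) -(comp_cat2 (sm_nat _ _)).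
  have /= fnat W W' (u : hom W W') := Phi_nat (a := OV _) (b := OV _) f u.
  rewrite (comp_cat2 (wh_cat2 B (esym (fnat _ _ _)))) -wh_comp.
  by rewrite (frob_zz_mirror HA FA) wh1 comp1r.
have -> : g \c alg_unit B = lunit A \c ((tB \c f) \om idm A) \c ca.
  rewrite /g; strict; fold_gen.
  by rewrite -su_nat -(comp_cat2 (su_nat _ _)) (comp_cat (sm1 HB _)) comp1l.
rewrite E tensm_Zl comp_Zl comp_Zr; congr (_ *: _).
strict; fold_gen.
by rewrite -[RHS]comp1l -(frob_zz FA) -!compA -su_nat (comp_cat (sm1 HA _)) comp1l.
Qed.

End GlobalSections.

(** * Localization at an idempotent *)

Section Localization.
Variables (k : fieldType) (T : tensor_category k).
Local Notation One := (unit_ob T).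
Implicit Types C D U V : etale T.

Section Summand.
Variables (C : etale T) (e : gam C) (X : T) (q : hom C X) (s : hom X C).
Hypotheses (qs : q \c s = idm X) (sq : s \c q = mu e).
Let HC : is_algebra C := et_alg C.

Lemma split_mu_l : mu e \c s = s.
Proof. by rewrite -sq -compA qs comp1r. Qed.
Lemma split_mu_r : q \c mu e = q.
Proof. by rewrite -sq compA qs comp1l. Qed.

(** The direct factor eC carried by a splitting of [mu e]; the inclusion [s] will preserve products
    but send 1 to e. *)
Definition summand_algebra : algebra_data T :=
  @AlgebraData k T X (q \c alg_unit C) (q \c alg_mul C \c (s \om s)).

Lemma summand_is_algebra : is_algebra summand_algebra.
Proof.
split=> /=.
- rewrite -!compA (compA (s \om s) (idm X \om _)) -!tensm_comp !comp1r.
  rewrite (compA s q) sq.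
  have -> : (mu e \c (alg_mul C \c (s \om s))) \om s =
      (mu e \om idm C) \c (alg_mul C \om idm C) \c ((s \om s) \om s).
    by rewrite -!tensm_comp !comp1l.
  have -> : s \om (mu e \c alg_mul C \c (s \om s)) =
      (idm C \om mu e) \c (idm C \om alg_mul C) \c (s \om (s \om s)).
    by rewrite -!tensm_comp !comp1l.
  rewrite -!compA -assoc_nat; congr (_ \c _).
  rewrite (compA (alg_mul C)) mu_mul_l // (compA (alg_mul C)) mu_mul_r //.
  rewrite -!compA; congr (_ \c _).
  by rewrite compA alg_mulA // -!compA.
- by rewrite -!compA -braid_nat (compA (alg_mul C)) alg_mulC.
- rewrite -!compA -tensm_comp comp1r (compA s) sq -[X in _ \om X]comp1l tensm_comp.
  rewrite (compA (alg_mul C)) mu_mul_l // !compA split_mu_r tensm_split.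
  by rewrite -!compA (compA (alg_mul C)) alg_mul1 // lunit_nat compA qs comp1l.
Qed.

Lemma summand_alg_hom : is_alg_hom (A := C) (B := summand_algebra) q.
Proof.
apply/andP; split; apply/eqP; rewrite //= -!compA -tensm_comp sq.
rewrite tensm_split (compA (alg_mul C)) mu_mul_l // -compA mu_mul_r //.
by rewrite !compA !split_mu_r.
Qed.
End Summand.

Section LocFrobenius.
Variables (C : etale T) (e : gam C) (U : algebra_data T) (q : alg_hom C U).
Variable s : hom U C.
Hypotheses (qs : q \c s = idm U) (sq : s \c q = mu e).
Let HC : is_algebra C := et_alg C.

Lemma split_mul : s \c alg_mul U = alg_mul C \c (s \om s).
Proof.
have /andP[_ /eqP qM] := ah_prop q.
have -> : alg_mul U = q \c alg_mul C \c (s \om s).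
  by rewrite compA qM -compA -tensm_comp qs tensm1 comp1r.
rewrite (compA s) sq compA -mu_mul_l // -compA -tensm_comp (split_mu_l qs sq).
by rewrite comp1l.
Qed.

(** Form and copairing of C cut down to the factor. In the snake, [mu e] slides from one argument of
    the product to the other and is absorbed by [s]. *)
Lemma split_frobenius t c : frobenius (A := C) t c ->
  frobenius (t \c s) ((q \om q) \c c).
Proof.
move=> F; have /andP[/eqP qu /eqP qM] := ah_prop q.
split; last by rewrite compA -qM -compA (frob_special F).
rewrite -compA split_mul.
have Ms := split_mu_l qs sq; strictify Ms => {}Ms.
have mM : alg_mul C \c (idm C \om mu e) = alg_mul C \c (mu e \om idm C).
  by rewrite mu_mul_l // mu_mul_r.
strictify mM => {}mM; strictify sq => SQ; strictify qs => QS.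
have /= Snat W W' (f : hom W W') := Phi_nat (a := OV _) (b := OV _) s f.
have /= Qnat W W' (f : hom W W') := Phi_nat (a := OV _) (b := OV _) (ah_val q) f.
have {}mM W : sm C W \c wh C (Phi (a := OV _) (b := OV _) (mu e) W) =
    sm C W \c Phi (a := OV (alg_ob C)) (b := OV (alg_ob C)) (mu e) (C \ox W).
  by have := mM W; strict_simpl.
strict; fold_gen.
rewrite (comp_cat (wh_cat U (SQ _))) (comp_cat2 (Snat _ _ _)).
rewrite (comp_cat2 (mM _)) (comp_cat (Ms _)) (comp_cat2 (Snat _ _ _)) Snat.
rewrite (comp_cat2 (sm_nat _ _)) (comp_cat2 (st_nat _ _)).
by rewrite (comp_cat3 (frob_zz F _)) comp1l QS.
Qed.
End LocFrobenius.

(* U is the direct factor e C of C. *)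
Definition loc C U (q : alg_hom C U) (e : gam C) : Prop :=
  exists s : hom U C, q \c s = idm U /\ s \c q = mu e.

Lemma loc_gmap1 C U (q : alg_hom C U) e : loc q e -> gmap q e = 1.
Proof.
move=> [s [qs sq]]; rewrite -(gmap1 q) /gmap -(mu_unit (et_alg C) e) -sq.
by rewrite !compA qs comp1l.
Qed.

(** Applying [s] undoes the restriction up to the factor e. *)
Lemma loc_gmap_eq C U (q : alg_hom C U) e x y :
  loc q e -> gmap q x = gmap q y -> e * x = e * y.
Proof.
move=> [s [qs sq]] E; rewrite -[e * x]/(mu e \c x) -[e * y]/(mu e \c y).
by rewrite -sq -!compA; congr (_ \c _).
Qed.

Lemma loc_idem C U (q : alg_hom C U) e : loc q e -> e * e = e.
Proof.
by move=> L; rewrite -[RHS]mulr1; apply: (loc_gmap_eq L); rewrite gmap1 (loc_gmap1 L).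
Qed.

Lemma loc_unique C U (q : alg_hom C U) e e' : loc q e -> loc q e' -> e = e'.
Proof.
move=> L L'.
have E1 : e * 1 = e * e'.
  by apply: (loc_gmap_eq L); rewrite gmap1 (loc_gmap1 L').
have E2 : e' * 1 = e' * e.
  by apply: (loc_gmap_eq L'); rewrite gmap1 (loc_gmap1 L).
by rewrite -[LHS]mulr1 E1 mulrC -E2 mulr1.
Qed.

Lemma loc_epi C U (q : alg_hom C U) e X (f g : hom U X) :
  loc q e -> f \c q = g \c q -> f = g.
Proof. by move=> [s [qs _]]; apply: comp_inj_iso_r qs. Qed.

(** The factorization is [f \c s]: the section is multiplicative, and f(e) = 1 repairs its failure
    to be unital. *)
Lemma loc_factor C U D (q : alg_hom C U) e (f : alg_hom C D) :
  loc q e -> gmap f e = 1 -> exists h : alg_hom U D, alg_comp h q = f.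
Proof.
move=> [s [qs sq]] fe; have /andP[/eqP fu /eqP fM] := ah_prop f.
have /andP[/eqP qu _] := ah_prop q.
have fmu : f \c mu e = f.
  by rewrite mu_hom [f \c e]fe mu1 ?comp1l //; apply: (et_alg D).
have H : is_alg_hom (A := U) (B := D) (f \c s).
  apply/andP; split; apply/eqP.
    by rewrite -qu -compA (compA s) sq compA fmu fu.
  by rewrite -compA (split_mul qs sq) compA fM -compA -tensm_comp.
by exists (AlgHom H); apply: alg_hom_inj; rewrite /= -compA sq fmu.
Qed.

Lemma loc_mono C U (q : alg_hom C U) e : loc q e -> @is_mono (EtOp T) U C q.
Proof.
move=> L D f g /(congr1 (@ah_val _ _ _ _)) /= E.
by apply: alg_hom_inj; apply: loc_epi L E.
Qed.

Lemma loc_trace C U (q : alg_hom C U) e :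
  loc q e -> trace U \c q = trace C \c mu e.
Proof.
move=> [s [qs sq]]; have [c F] := trace_frob C.
by rewrite -(frob_traceE (split_frobenius qs sq F)) -compA sq.
Qed.

Lemma loc_iso C D U (f : alg_hom C D) (g : alg_hom D C) (q : alg_hom D U) e :
  alg_comp f g = alg_id D -> alg_comp g f = alg_id C -> loc q e ->
  loc (alg_comp q f) (gmap g e).
Proof.
move=> /(congr1 (@ah_val _ _ _ _)) /= fg /(congr1 (@ah_val _ _ _ _)) /= gf.
move=> [s [qs sq]]; exists (g \c s) => /=; split.
  by rewrite -compA (compA (ah_val f)) fg comp1l.
by rewrite -compA (compA s) sq compA mu_hom -compA gf comp1r.
Qed.

Lemma loc_isor C U V (q : alg_hom C U) (f : alg_hom U V) (g : alg_hom V U) e :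
  alg_comp f g = alg_id V -> alg_comp g f = alg_id U -> loc q e ->
  loc (alg_comp f q) e.
Proof.
move=> /(congr1 (@ah_val _ _ _ _)) /= fg /(congr1 (@ah_val _ _ _ _)) /= gf.
move=> [s [qs sq]]; exists (s \c g) => /=; split.
  by rewrite -compA (compA (ah_val q)) qs comp1l.
by rewrite -compA (compA (ah_val g)) gf comp1l.
Qed.

(** The idempotent e' of U is lifted along the section of the first localization to an idempotent of
    C below e. *)
Lemma loc_comp C U V (q : alg_hom C U) e (q' : alg_hom U V) e' :
  loc q e -> loc q' e' ->
  exists e0 : gam C, [/\ loc (alg_comp q' q) e0, gmap q e0 = e' & e * e0 = e0].
Proof.
move=> L [s' [qs' sq']]; have [s [qs sq]] := L.
have qe : gmap q (s \c e') = e' by rewrite /gmap compA qs comp1l.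
have ee : e * (s \c e' : gam C) = (s \c e' : gam C).
  by rewrite -[LHS]/(mu e \c s \c e') compA (split_mu_l qs sq).
exists (s \c e'); split=> //; exists (s \c s') => /=; split.
  by rewrite -compA (compA (ah_val q)) qs comp1l.
rewrite -compA (compA s') sq' -{1}qe -mu_hom compA sq mu_comp //.
  by congr mu.
exact: (et_alg C).
Qed.

Section Karoubi.
Hypothesis HT : karoubian T.

(** A splitting of [mu e] in [T] inherits from C both the multiplication and the form, hence is
    etale. *)
Lemma loc_exists C (e : gam C) :
  e * e = e -> exists (U : etale T) (q : alg_hom C U), loc q e.
Proof.
move=> ee; have HC := et_alg C.
have [|X [q [s [qs sq]]]] := HT (e := mu e).
  by rewrite mu_comp // -[mu e \c e]/(e * e) ee.
pose q' := AlgHom (summand_alg_hom qs sq).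
have [c F] := trace_frob C.
have FU := split_frobenius (q := q') qs sq F.
pose U := Etale (frob_etale (summand_is_algebra qs sq) FU).
by exists U, q', s.
Qed.

(** The universal property fixes the factor up to isomorphism, so the linear section is borrowed
    from the factor obtained by splitting [mu e]. *)
Lemma loc_univ C U (q : alg_hom C U) e :
  e * e = e -> gmap q e = 1 ->
  (forall D (f : alg_hom C D), gmap f e = 1 ->
     exists! h : alg_hom U D, alg_comp h q = f) -> loc q e.
Proof.
move=> ee qe univ; have [V [q' L]] := loc_exists ee.
have [g gq] := loc_factor L qe.
have [f [fq _]] := univ V q' (loc_gmap1 L).
rewrite -gq; apply: (loc_isor (g := f) _ _ L).
  have [h [_ hu]] := univ U q qe.
  rewrite -(hu (alg_id U)); last by apply: alg_hom_inj; rewrite /= comp1l.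
  symmetry; apply: hu; apply: alg_hom_inj.
  by rewrite /= -compA -[f \c q]/(ah_val (alg_comp f q)) fq -gq.
apply: alg_hom_inj; apply: (loc_epi L).
by rewrite comp1l /= -compA -[g \c q']/(ah_val (alg_comp g q')) gq -fq.
Qed.
End Karoubi.
End Localization.

(** * Coproducts in the opposite category *)

Section Products.
Variables (k : fieldType) (T : tensor_category k).
Local Notation One := (unit_ob T).
Implicit Types C D U V : etale T.

(** When pairings and copairings correspond along i and q, the map q intertwines the snake
    composites; the snake identity on a biproduct can thus be checked one component at a time. *)
Lemma zigzag_transfer (P U : T) (i : hom U P) (q : hom P U)
    (b : hom (P \ox P) One) (b' : hom (U \ox U) One)
    (c : hom One (P \ox P)) (c' : hom One (U \ox U)) :
  (idm P \om q) \c c = (i \om idm U) \c c' ->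
  b \c (idm P \om i) = b' \c (q \om idm U) ->
  q \c (lunit P \c (b \om idm P) \c assocV P P P \c (idm P \om c) \c runitV P) =
  (lunit U \c (b' \om idm U) \c assocV U U U \c (idm U \om c') \c runitV U) \c q.
Proof.
move=> H K; strictify H => {}H; strictify K => {}K.
strict.
have {}H W : wh P (Phi (a := OV P) (b := OV U) q W) \c
    Phi (a := O1 T) (b := OT (OV P) (OV P)) c W =
    Phi (a := OV U) (b := OV P) i (U \ox W) \c
    Phi (a := O1 T) (b := OT (OV U) (OV U)) c' W by have := H W; strict_simpl.
have {}K W : Phi (a := OT (OV P) (OV P)) (b := O1 T) b W \c
    wh P (Phi (a := OV U) (b := OV P) i W) =
    Phi (a := OT (OV U) (OV U)) (b := O1 T) b' W \c
    Phi (a := OV P) (b := OV U) q (U \ox W) by have := K W; strict_simpl.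
have /= bnat W W' (f : hom W W') :=
  Phi_nat (a := OT (OV P) (OV P)) (b := O1 T) b f.
have /= qnat W W' (f : hom W W') := Phi_nat (a := OV _) (b := OV _) q f.
rewrite -(comp_cat2 (bnat _ _ _)) (wh_cat2 P (H _)) (comp_cat2 (K _)).
by rewrite qnat.
Qed.

(** * The product of two etale algebras, carried by a biproduct *)

Section Biproduct.
Variables (U V : etale T) (P : T).
Variables (i1 : hom U P) (i2 : hom V P) (p1 : hom P U) (p2 : hom P V).
Hypotheses (e11 : p1 \c i1 = idm U) (e22 : p2 \c i2 = idm V).
Hypotheses (e12 : p1 \c i2 = 0) (e21 : p2 \c i1 = 0).
Hypothesis e : (i1 \c p1) + (i2 \c p2) = idm P.

Lemma biproduct_monic X (f g : hom X P) :
  p1 \c f = p1 \c g -> p2 \c f = p2 \c g -> f = g.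
Proof.
move=> E1 E2; rewrite -(comp1l f) -(comp1l g) -e !comp_Dl -!compA.
by rewrite E1 E2.
Qed.

Definition biproduct_algebra : algebra_data T :=
  @AlgebraData k T P ((i1 \c alg_unit U) + (i2 \c alg_unit V))
    ((i1 \c alg_mul U \c (p1 \om p1)) + (i2 \c alg_mul V \c (p2 \om p2))).

Lemma biproduct_p1_hom : is_alg_hom (A := biproduct_algebra) (B := U) p1.
Proof.
apply/andP; split; apply/eqP; rewrite /= comp_Dr !compA e11 e12.
  by rewrite comp1l comp_0l addr0.
by rewrite comp1l !comp_0l addr0.
Qed.

Lemma biproduct_p2_hom : is_alg_hom (A := biproduct_algebra) (B := V) p2.
Proof.
apply/andP; split; apply/eqP; rewrite /= comp_Dr !compA e22 e21.
  by rewrite comp1l comp_0l add0r.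
by rewrite comp1l !comp_0l add0r.
Qed.

Lemma biproduct_is_algebra : is_algebra biproduct_algebra.
Proof.
have /andP[/eqP p1u /eqP p1M] := biproduct_p1_hom.
have /andP[/eqP p2u /eqP p2M] := biproduct_p2_hom.
have HU := et_alg U; have HV := et_alg V.
split.
- have A C (HC : is_algebra C) (p : hom P C) :
      p \c alg_mul biproduct_algebra = alg_mul C \c (p \om p) ->
      p \c alg_mul biproduct_algebra \c (alg_mul biproduct_algebra \om idm P) =
      p \c alg_mul biproduct_algebra \c (idm P \om alg_mul biproduct_algebra)
        \c assoc P P P.
    move=> pM; have EL : (p \om p) \c (alg_mul biproduct_algebra \om idm P) =
        (alg_mul C \om idm C) \c ((p \om p) \om p).
      by rewrite -!tensm_comp pM comp1l comp1r.
    have ER : (p \om p) \c (idm P \om alg_mul biproduct_algebra) =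
        (idm C \om alg_mul C) \c (p \om (p \om p)).
      by rewrite -!tensm_comp pM comp1l comp1r.
    rewrite !(compA p) pM -!compA EL (compA (p \om p)) ER -!compA -assoc_nat.
    by rewrite (compA _ (alg_mul C \om _)) alg_mulA // -!compA.
  by apply: biproduct_monic; apply: A.
- apply: biproduct_monic; rewrite compA ?p1M ?p2M -compA -braid_nat compA.
    by rewrite alg_mulC.
  by rewrite alg_mulC.
- have A C (HC : is_algebra C) (p : hom P C) :
      p \c alg_unit biproduct_algebra = alg_unit C ->
      p \c alg_mul biproduct_algebra = alg_mul C \c (p \om p) ->
      p \c alg_mul biproduct_algebra \c (alg_unit biproduct_algebra \om idm P) =
      p \c lunit P.
    move=> pu pM; rewrite compA pM -compA -tensm_comp pu comp1r tensm_split.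
    by rewrite compA alg_mul1 // lunit_nat.
  by apply: biproduct_monic; apply: A.
Qed.

Variables (tU : hom U One) (tV : hom V One).
Variables (cU : hom One (U \ox U)) (cV : hom One (V \ox V)).
Hypotheses (FU : frobenius tU cU) (FV : frobenius tV cV).

Lemma biproduct_frobenius :
  frobenius (A := biproduct_algebra) ((tU \c p1) + (tV \c p2))
    (((i1 \om i1) \c cU) + ((i2 \om i2) \c cV)).
Proof.
have /andP[/eqP p1u /eqP p1M] := biproduct_p1_hom.
have /andP[/eqP p2u /eqP p2M] := biproduct_p2_hom.
split.
  apply: biproduct_monic.
    rewrite (zigzag_transfer (i := i1) (b' := tU \c alg_mul U) (c' := cU)).
    - by rewrite (frob_zigzag FU) comp1l comp1r.
    - rewrite comp_Dr !compA -!tensm_comp !comp1l e11 e12 tensm_0r comp_0l.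
      by rewrite addr0.
    - rewrite !comp_Dl -!compA !(compA _ (alg_mul biproduct_algebra)) p1M p2M.
      rewrite -!compA -!tensm_comp !comp1r e11 e21 tensm_0r !comp_0r.
      by rewrite addr0.
  rewrite (zigzag_transfer (i := i2) (b' := tV \c alg_mul V) (c' := cV)).
  - by rewrite (frob_zigzag FV) comp1l comp1r.
  - rewrite comp_Dr !compA -!tensm_comp !comp1l e22 e21 tensm_0r comp_0l.
    by rewrite add0r.
  - rewrite !comp_Dl -!compA !(compA _ (alg_mul biproduct_algebra)) p1M p2M.
    rewrite -!compA -!tensm_comp !comp1r e22 e12 tensm_0r !comp_0r.
    by rewrite add0r.
apply: biproduct_monic.
  rewrite compA p1M p1u comp_Dr !(compA _ (_ \om _)) -!(compA (alg_mul U)).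
  rewrite -!tensm_comp e11 e12 tensm1 tensm_0r !(comp1l, comp1r, comp_0r, comp_0l) addr0.
  exact: frob_special FU.
rewrite compA p2M p2u comp_Dr !(compA _ (_ \om _)) -!(compA (alg_mul V)).
rewrite -!tensm_comp e22 e21 tensm1 tensm_0r !(comp1l, comp1r, comp_0r, comp_0l) add0r.
exact: frob_special FV.
Qed.

Lemma biproduct_loc1 (E : etale_structure biproduct_algebra) :
  loc (C := Etale E) (AlgHom biproduct_p1_hom) (i1 \c alg_unit U).
Proof.
exists i1; split=> //=; apply: biproduct_monic.
  rewrite (mu_hom (AlgHom biproduct_p1_hom)) /= !compA e11 !comp1l.
  by rewrite mu1 ?comp1l //; apply: (et_alg U).
rewrite (mu_hom (AlgHom biproduct_p2_hom)) /= !compA e21 !comp_0l.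
by rewrite muE tensm_0l comp_0l comp_0r comp_0l.
Qed.

Lemma biproduct_loc2 (E : etale_structure biproduct_algebra) :
  loc (C := Etale E) (AlgHom biproduct_p2_hom) (i2 \c alg_unit V).
Proof.
exists i2; split=> //=; apply: biproduct_monic.
  rewrite (mu_hom (AlgHom biproduct_p1_hom)) /= !compA e12 !comp_0l.
  by rewrite muE tensm_0l comp_0l comp_0r comp_0l.
rewrite (mu_hom (AlgHom biproduct_p2_hom)) /= !compA e22 !comp1l.
by rewrite mu1 ?comp1l //; apply: (et_alg V).
Qed.
End Biproduct.

(** A concrete product in [Et], hence a concrete coproduct in [EtOp], with which abstract ones are
    compared. *)
Lemma product_exists U V : exists (P : etale T) (p1 : alg_hom P U)
  (p2 : alg_hom P V) (e1 e2 : gam P), [/\ loc p1 e1, loc p2 e2 & e1 + e2 = 1].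
Proof.
have [P [i1 [i2 [p1 [p2 [e11 e22 e12 e21 e]]]]]] := has_biproducts U V.
have [cU FU] := trace_frob U; have [cV FV] := trace_frob V.
have F := biproduct_frobenius e11 e22 e12 e21 e FU FV.
pose E := frob_etale (biproduct_is_algebra e11 e22 e12 e21 e) F.
exists (Etale E); exists (AlgHom (biproduct_p1_hom p2 e11 e12)).
exists (AlgHom (biproduct_p2_hom p1 e22 e21)).
exists (i1 \c alg_unit U : hom One P), (i2 \c alg_unit V : hom One P).
split=> //; [exact: (biproduct_loc1 e11 e22 e12 e21 e E)
            |exact: (biproduct_loc2 e11 e22 e12 e21 e E)].
Qed.

Lemma idem_orth (R : comPzRingType) (e1 e2 : R) :
  e1 * e1 = e1 -> e1 + e2 = 1 -> e1 * e2 = 0.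
Proof.
move=> ee es; have -> : e2 = 1 - e1 by rewrite -es addrC addKr.
by rewrite mulrBr mulr1 ee subrr.
Qed.

Section Orthogonal.
Variables (C U V : etale T) (q1 : alg_hom C U) (q2 : alg_hom C V).
Variables (e1 e2 : gam C) (s1 : hom U C) (s2 : hom V C).
Hypotheses (qs1 : q1 \c s1 = idm U) (sq1 : s1 \c q1 = mu e1).
Hypotheses (qs2 : q2 \c s2 = idm V) (sq2 : s2 \c q2 = mu e2).
Hypothesis e12 : e1 * e2 = 0.

Lemma split_orth : q1 \c s2 = 0.
Proof.
have -> : q1 \c s2 = q1 \c mu e1 \c mu e2 \c s2.
  by rewrite (split_mu_l qs2 sq2) compA (split_mu_r qs1 sq1).
rewrite (compA (mu e1)) mu_comp; last exact: (et_alg C).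
rewrite -[mu e1 \c e2]/(e1 * e2) e12 muE tensm_0l.
by rewrite comp_0l !comp_0r comp_0l comp_0r.
Qed.
End Orthogonal.

Lemma alg_hom_through C D U (q : alg_hom C U) (f : alg_hom D U) (h : hom D C) :
  q \c h = f ->
  q \c h \c alg_unit D = q \c alg_unit C /\
  q \c h \c alg_mul D = q \c alg_mul C \c (h \om h).
Proof.
move=> qh; have /andP[/eqP fu /eqP fM] := ah_prop f.
have /andP[/eqP qu /eqP qM] := ah_prop q.
rewrite !(compA (ah_val q)) qh fu fM qu qM; split=> //.
by rewrite -compA -tensm_comp qh.
Qed.

(** The mediating map is [(s1 \c f) + (s2 \c g)]. As the idempotents sum to 1, the two projections
    are jointly monic, so its being an algebra map is tested after each of them. *)
Lemma coproduct2_of_loc C U V (q1 : alg_hom C U) (q2 : alg_hom C V) e1 e2 :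
  loc q1 e1 -> loc q2 e2 -> e1 + e2 = 1 ->
  @is_coproduct2 (EtOp T) U V C q1 q2.
Proof.
move=> L1 L2 es D f g.
have e12 := idem_orth (loc_idem L1) es.
have [s1 [qs1 sq1]] := L1; have [s2 [qs2 sq2]] := L2.
have o12 := split_orth qs1 sq1 qs2 sq2 e12.
have o21 := split_orth qs2 sq2 qs1 sq1 (etrans (mulrC _ _) e12).
have jm X (a b : hom X C) : q1 \c a = q1 \c b -> q2 \c a = q2 \c b -> a = b.
  move=> E1 E2; rewrite -(comp1l a) -(comp1l b) -(mu1 (et_alg C)).
  rewrite -[alg_unit C]/(1 : gam C) -es muD -sq1 -sq2 !comp_Dl -!compA.
  by rewrite E1 E2.
pose h := (s1 \c f) + (s2 \c g).
have h1 : q1 \c h = f.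
  by rewrite comp_Dr !compA qs1 o12 comp1l comp_0l addr0.
have h2 : q2 \c h = g.
  by rewrite comp_Dr !compA qs2 o21 comp1l comp_0l add0r.
have [u1 m1] := alg_hom_through h1; have [u2 m2] := alg_hom_through h2.
have H : is_alg_hom (A := D) (B := C) h.
  by apply/andP; split; apply/eqP; apply: jm.
exists (AlgHom H); split; first by split; apply: alg_hom_inj.
move=> h' [] /(congr1 (@ah_val _ _ _ _)) /= E1.
move=> /(congr1 (@ah_val _ _ _ _)) /= E2.
by apply: alg_hom_inj; apply: jm; rewrite /= ?h1 ?h2 ?E1 ?E2.
Qed.

Lemma coproduct3_of_loc C U V (W : etale T) (q1 : alg_hom C U) (q2 : alg_hom C V)
    (q3 : alg_hom C W) e1 e2 e3 :
  loc q1 e1 -> loc q2 e2 -> loc q3 e3 -> e1 + e2 + e3 = 1 ->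
  e1 * e2 = 0 -> e1 * e3 = 0 -> e2 * e3 = 0 ->
  @is_coproduct3 (EtOp T) U V W C q1 q2 q3.
Proof.
move=> L1 L2 L3 es e12 e13 e23 D f g l.
have [s1 [qs1 sq1]] := L1; have [s2 [qs2 sq2]] := L2; have [s3 [qs3 sq3]] := L3.
have o12 := split_orth qs1 sq1 qs2 sq2 e12.
have o21 := split_orth qs2 sq2 qs1 sq1 (etrans (mulrC _ _) e12).
have o13 := split_orth qs1 sq1 qs3 sq3 e13.
have o31 := split_orth qs3 sq3 qs1 sq1 (etrans (mulrC _ _) e13).
have o23 := split_orth qs2 sq2 qs3 sq3 e23.
have o32 := split_orth qs3 sq3 qs2 sq2 (etrans (mulrC _ _) e23).
have jm X (a b : hom X C) : q1 \c a = q1 \c b -> q2 \c a = q2 \c b ->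
    q3 \c a = q3 \c b -> a = b.
  move=> E1 E2 E3; rewrite -(comp1l a) -(comp1l b) -(mu1 (et_alg C)).
  rewrite -[alg_unit C]/(1 : gam C) -es !muD -sq1 -sq2 -sq3 !comp_Dl -!compA.
  by rewrite E1 E2 E3.
pose h := (s1 \c f) + (s2 \c g) + (s3 \c l).
have h1 : q1 \c h = f.
  by rewrite !comp_Dr !compA qs1 o12 o13 comp1l !comp_0l !addr0.
have h2 : q2 \c h = g.
  by rewrite !comp_Dr !compA qs2 o21 o23 comp1l !comp_0l addr0 add0r.
have h3 : q3 \c h = l.
  by rewrite !comp_Dr !compA qs3 o31 o32 comp1l !comp_0l !add0r.
have [u1 m1] := alg_hom_through h1; have [u2 m2] := alg_hom_through h2.
have [u3 m3] := alg_hom_through h3.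
have H : is_alg_hom (A := D) (B := C) h.
  by apply/andP; split; apply/eqP; apply: jm.
exists (AlgHom H); split; first by split; apply: alg_hom_inj.
move=> h' [] /(congr1 (@ah_val _ _ _ _)) /= E1.
move=> /(congr1 (@ah_val _ _ _ _)) /= E2 /(congr1 (@ah_val _ _ _ _)) /= E3.
by apply: alg_hom_inj; apply: jm; rewrite /= ?h1 ?h2 ?h3 ?E1 ?E2 ?E3.
Qed.

(** The hypothesis concerns algebra maps only and yields no linear section; the sections and
    idempotents come from the biproduct algebra, through the unique isomorphism with it. *)
Lemma loc_of_coproduct2 C U V (q1 : alg_hom C U) (q2 : alg_hom C V) :
  @is_coproduct2 (EtOp T) U V C q1 q2 ->
  exists e1 e2 : gam C, [/\ loc q1 e1, loc q2 e2 & e1 + e2 = 1].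
Proof.
move=> univ; have [P [p1 [p2 [e1 [e2 [L1 L2 es]]]]]] := product_exists U V.
have univP := coproduct2_of_loc L1 L2 es.
have [f [[f1 f2] _]] := univP C q1 q2.
have [g [[g1 g2] _]] := univ P p1 p2.
have fg : alg_comp f g = alg_id P.
  have [x [_ xu]] := univP P p1 p2.
  rewrite -(xu (alg_id P)); last by split; apply: alg_hom_inj; rewrite /= comp1r.
  by symmetry; apply: xu; split; apply: alg_hom_inj;
    rewrite -?{2}g1 -?{2}g2 -?f1 -?f2 /= compA.
have gf : alg_comp g f = alg_id C.
  have [x [_ xu]] := univ C q1 q2.
  rewrite -(xu (alg_id C)); last by split; apply: alg_hom_inj; rewrite /= comp1r.
  by symmetry; apply: xu; split; apply: alg_hom_inj;
    rewrite -?{2}f1 -?{2}f2 -?g1 -?g2 /= compA.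
exists (gmap g e1), (gmap g e2); split.
- by move: f1 => <-; apply: loc_iso.
- by move: f2 => <-; apply: loc_iso.
- by rewrite -gmapD es gmap1.
Qed.

Lemma loc_of_coproduct3 C U V (W : etale T) (q1 : alg_hom C U)
    (q2 : alg_hom C V) (q3 : alg_hom C W) :
  @is_coproduct3 (EtOp T) U V W C q1 q2 q3 ->
  exists e1 e2 e3 : gam C, [/\ loc q1 e1, loc q2 e2, loc q3 e3 &
    [/\ e1 + e2 + e3 = 1, e1 * e2 = 0, e1 * e3 = 0 & e2 * e3 = 0]].
Proof.
(* A ternary product as an iterated binary one: [d] cuts out the product [Q] of U and V, and [e1],
   [e2] lift the idempotents of [Q] to [P]. *)
move=> univ; have [Q [a1 [a2 [d1 [d2 [M1 M2 ds]]]]]] := product_exists U V.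
have [P [b [p3 [d [e3 [Mb L3 es]]]]]] := product_exists Q W.
have [e1 [L1 be1 de1]] := loc_comp Mb M1.
have [e2 [L2 be2 de2]] := loc_comp Mb M2.
set p1 := alg_comp a1 b in L1; set p2 := alg_comp a2 b in L2.
have e12 : e1 + e2 = d.
  rewrite -de1 -de2 -mulrDr -[RHS]mulr1; apply: (loc_gmap_eq Mb).
  by rewrite gmapD be1 be2 gmap1.
have o12 : e1 * e2 = 0.
  rewrite -de2 mulrCA -(mulr0 d); apply: (loc_gmap_eq Mb).
  by rewrite gmapM be1 be2 gmap0 (idem_orth (loc_idem M1)).
have dd3 : d * e3 = 0 by apply: idem_orth es; apply: loc_idem Mb.
have o13 : e1 * e3 = 0 by rewrite -de1 mulrAC dd3 mul0r.
have o23 : e2 * e3 = 0 by rewrite -de2 mulrAC dd3 mul0r.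
have s3 : e1 + e2 + e3 = 1 by rewrite e12.
have univP := coproduct3_of_loc L1 L2 L3 s3 o12 o13 o23.
have [f [[f1 f2 f3] _]] := univP C q1 q2 q3.
have [g [[g1 g2 g3] _]] := univ P p1 p2 p3.
have fg : alg_comp f g = alg_id P.
  have [x [_ xu]] := univP P p1 p2 p3.
  rewrite -(xu (alg_id P)); last by split; apply: alg_hom_inj; rewrite /= comp1r.
  by symmetry; apply: xu; split; apply: alg_hom_inj;
    rewrite -?{2}g1 -?{2}g2 -?{2}g3 -?f1 -?f2 -?f3 /= !compA.
have gf : alg_comp g f = alg_id C.
  have [x [_ xu]] := univ C q1 q2 q3.
  rewrite -(xu (alg_id C)); last by split; apply: alg_hom_inj; rewrite /= comp1r.
  by symmetry; apply: xu; split; apply: alg_hom_inj;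
    rewrite -?{2}f1 -?{2}f2 -?{2}f3 -?g1 -?g2 -?g3 /= !compA.
exists (gmap g e1), (gmap g e2), (gmap g e3); split.
- by rewrite -f1; apply: loc_iso.
- by rewrite -f2; apply: loc_iso.
- by rewrite -f3; apply: loc_iso.
- by rewrite -!gmapD -!gmapM o12 o13 o23 s3 gmap1 gmap0.
Qed.

(** A section of q is assembled from those of the two pieces as [(s1 \c i) + (s2 \c j)]; the
    coproduct hypothesis makes i and j jointly monic. *)
Lemma loc_glue C D U V (q : alg_hom C D) (i : alg_hom D U) (j : alg_hom D V)
    e1 e2 :
  loc (alg_comp i q) e1 -> loc (alg_comp j q) e2 -> e1 * e2 = 0 ->
  @is_coproduct2 (EtOp T) U V D i j -> loc q (e1 + e2).
Proof.
move=> [s1 [qs1 sq1]] [s2 [qs2 sq2]] o.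
move=> /loc_of_coproduct2 [d1 [d2 [[t1 [it1 ti1]] [t2 [jt2 tj2]] ds]]].
have o12 := split_orth qs1 sq1 qs2 sq2 o.
have o21 := split_orth qs2 sq2 qs1 sq1 (etrans (mulrC _ _) o).
have jm X (a b : hom X D) : i \c a = i \c b -> j \c a = j \c b -> a = b.
  move=> E1 E2; rewrite -(comp1l a) -(comp1l b) -(mu1 (et_alg D)).
  rewrite -[alg_unit D]/(1 : gam D) -ds muD -ti1 -tj2 !comp_Dl -!compA.
  by rewrite E1 E2.
exists ((s1 \c i) + (s2 \c j)); split.
  apply: jm; rewrite !comp_Dr !compA.
    by rewrite [(i \c q) \c s1]qs1 [(i \c q) \c s2]o12 comp1l comp_0l addr0 comp1r.
  by rewrite [(j \c q) \c s1]o21 [(j \c q) \c s2]qs2 comp1l comp_0l add0r comp1r.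
by rewrite comp_Dl -!compA [s1 \c _]sq1 [s2 \c _]sq2 muD.
Qed.

Lemma loc_restrict C D U (q : alg_hom C D) (i : alg_hom D U) e e1 :
  loc q e -> loc (alg_comp i q) e1 -> loc i (gmap q e1).
Proof.
move=> L [s [qs sq]]; exists (q \c s); split; first by rewrite compA.
apply: (loc_epi L); rewrite -mu_hom -!compA; congr (_ \c _).
exact: sq.
Qed.

Lemma trace_coproduct2 C U V (q1 : alg_hom C U) (q2 : alg_hom C V) :
  @is_coproduct2 (EtOp T) U V C q1 q2 ->
  trace C = (trace U \c q1) + (trace V \c q2).
Proof.
move=> /loc_of_coproduct2 [e1 [e2 [L1 L2 es]]].
rewrite (loc_trace L1) (loc_trace L2) -comp_Dr -muD es mu1 ?comp1r //.
exact: (et_alg C).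
Qed.

End Products.

Section Pairing.
Variable S : category.
Variables (X Y : S) (P : product_of X Y).

Lemma pair_exists (D : S) (f : chom D X) (g : chom D Y) :
  exists h : chom D P, is_pair h f g.
Proof. by have [h [Hh _]] := pr_univ P f g; exists h. Qed.

Lemma pair_eq (D : S) (h h' : chom D P) :
  pr1 P \k h = pr1 P \k h' -> pr2 P \k h = pr2 P \k h' -> h = h'.
Proof.
move=> E1 E2; have [l [_ u]] := pr_univ P (pr1 P \k h) (pr2 P \k h).
by rewrite -(u h) // -(u h').
Qed.
End Pairing.

(** * Geometric language in the opposite category: points, pullback of sections, loci *)

Section Opposite.
Variables (k : fieldType) (T : tensor_category k).
Local Notation One := (unit_ob T).
Local Notation S := (EtOp T).

Definition pull (D' D : S) (f : chom D' D) (e : gam (D : etale T)) :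
  gam (D' : etale T) := @gmap k T D D' f e.

Section Pull.
Variables (D' D : S) (f : chom D' D).
Lemma pullM x y : pull f (x * y) = pull f x * pull f y. Proof. exact: gmapM. Qed.
Lemma pullD x y : pull f (x + y) = pull f x + pull f y. Proof. exact: gmapD. Qed.
Lemma pull1 : pull f 1 = 1. Proof. exact: gmap1. Qed.
Lemma pull0 : pull f 0 = 0. Proof. exact: gmap0. Qed.
Lemma pull_comp D'' (g : chom D'' D') x : pull (f \k g) x = pull g (pull f x).
Proof. exact: gmap_comp. Qed.
End Pull.

Definition sloc (U C : S) (q : chom U C) (e : gam (C : etale T)) : Prop :=
  @loc k T C U q e.

Section Sloc.
Variables (U C : S) (q : chom U C) (e : gam (C : etale T)).

Lemma sloc_factor (D : S) (f : chom D C) :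
  sloc q e -> pull f e = 1 -> exists h : chom D U, q \k h = f.
Proof. exact: loc_factor. Qed.

Lemma sloc_mono : sloc q e -> is_mono q.
Proof. exact: loc_mono. Qed.

Lemma sloc_pull : sloc q e -> pull q e = 1.
Proof. exact: loc_gmap1. Qed.

Lemma sloc_univ : karoubian T -> e * e = e -> pull q e = 1 ->
  (forall (D : S) (f : chom D C), pull f e = 1 ->
     exists! h : chom D U, q \k h = f) -> sloc q e.
Proof. by move=> HT; exact: (@loc_univ k T HT C U q e). Qed.

Lemma sloc_factor_pull (D : S) (h : chom D U) :
  sloc q e -> pull (q \k h) e = 1.
Proof. by move=> L; rewrite pull_comp sloc_pull // pull1. Qed.
End Sloc.

Lemma sloc_exists (C : S) (e : gam (C : etale T)) :
  karoubian T -> e * e = e -> exists U : subobject C, sloc (sub_map U) e.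
Proof.
move=> HT ee; have [U [q L]] := loc_exists HT ee.
by exists (@Subobject S C U q (sloc_mono L)).
Qed.

Lemma tensor_etale (A B : etale T) :
  inhabited (etale_structure (tensor_algebra A B)).
Proof.
have [cA FA] := trace_frob A; have [cB FB] := trace_frob B.
constructor; apply: frob_etale.
  by apply: tensor_is_algebra; apply: et_alg; [exact: A | exact: B].
exact: tensor_frobenius FA FB.
Qed.

Section TensorEtale.
Variables (A B : etale T) (E : etale_structure (tensor_algebra A B)).

Lemma tensor_traceE : trace (Etale E) = lunit One \c (trace A \om trace B).
Proof.
have [cA FA] := trace_frob A; have [cB FB] := trace_frob B.
have F := tensor_frobenius FA FB.
by rewrite -(frob_traceE (A := Etale E) F).
Qed.

Definition tensor_pr1 : alg_hom A (Etale E) :=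
  AlgHom (tensor_in1_subproof A (et_alg B)).
Definition tensor_pr2 : alg_hom B (Etale E) :=
  AlgHom (tensor_in2_subproof B (et_alg A)).

Lemma tensor_is_product : @is_product S A B (Etale E) tensor_pr1 tensor_pr2.
Proof.
move=> D f g; exists (copair (et_alg D) f g); split.
  by split; apply: alg_hom_inj; [exact: copair_in1 | exact: copair_in2].
move=> h [] /(congr1 (@ah_val _ _ _ _)) /= E1 /(congr1 (@ah_val _ _ _ _)) /= E2.
apply: alg_hom_inj => /=; symmetry.
exact: (copair_unique (et_alg A) (et_alg B) E1 E2).
Qed.
End TensorEtale.

Lemma product_of_exists (X Y : S) : inhabited (product_of X Y).
Proof.
have [E] := tensor_etale X Y.
by constructor; exact: (ProductOf (tensor_is_product E)).
Qed.

End Opposite.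

(** * Total orders as relations valued in idempotents *)

Section Orders.
Variables (k : fieldType) (T : tensor_category k).
Hypothesis HT : karoubian T.
Local Notation S := (EtOp T).

Definition point_rel (X : S) := forall D : S, chom D X -> chom D X -> gam (D : etale T).

(** Transitivity and the meaning of equality are required only at the value 1; naturality, combined
    with restriction to loci, extends them to the idempotent identities below. *)
Record ordered_rel (X : S) (lt eq : point_rel X) : Prop := OrderedRel {
  or_lt_nat : forall (D E : S) (f : chom E D) x y,
    pull f (lt D x y) = lt E (x \k f) (y \k f);
  or_eq_nat : forall (D E : S) (f : chom E D) x y,
    pull f (eq D x y) = eq E (x \k f) (y \k f);
  or_total : forall (D : S) (x y : chom D X), lt D x y + eq D x y + lt D y x = 1;
  or_lt_eq : forall (D : S) (x y : chom D X), lt D x y * eq D x y = 0;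
  or_lt_gt : forall (D : S) (x y : chom D X), lt D x y * lt D y x = 0;
  or_eq_gt : forall (D : S) (x y : chom D X), eq D x y * lt D y x = 0;
  or_eqP : forall (D : S) (x y : chom D X), eq D x y = 1 <-> x = y;
  or_trans : forall (D : S) (x y z : chom D X),
    lt D x y = 1 -> lt D y z = 1 -> lt D x z = 1
}.

Section Theory.
Variables (X : S) (lt eq : point_rel X).
Hypothesis O : ordered_rel lt eq.
Variable D : S.
Implicit Types x y z : chom D X.

Lemma or_lt_idem x y : lt x y * lt x y = lt x y.
Proof.
rewrite -[RHS]mulr1 -(or_total O x y) !mulrDr.
by rewrite (or_lt_eq O) (or_lt_gt O) !addr0.
Qed.

Lemma or_eq_idem x y : eq x y * eq x y = eq x y.
Proof.
rewrite -[RHS]mulr1 -(or_total O x y) !mulrDr.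
by rewrite (or_eq_gt O) [eq x y * lt x y]mulrC (or_lt_eq O) addr0 add0r.
Qed.

Lemma or_eq_refl x : eq x x = 1.
Proof. exact/(or_eqP O). Qed.

(** After restriction to the locus of e, the idempotent becomes 1 and the clauses of [ordered_rel]
    about the value 1 apply. *)
Lemma local_eq (e u v : gam (D : etale T)) :
  e * e = e ->
  (forall (U : S) (q : chom U D), pull q e = 1 -> pull q u = pull q v) ->
  e * u = e * v.
Proof.
move=> ee H; have [[U q mq] /= L] := sloc_exists HT ee.
by apply: (loc_gmap_eq (q := q) L); apply: H; apply: sloc_pull L.
Qed.

Lemma or_eq_subst x y z : eq x y * lt y z = eq x y * lt x z.
Proof.
apply: local_eq => [|U q]; first exact: or_eq_idem.
by rewrite (or_eq_nat O) !(or_lt_nat O) => /(or_eqP O) ->.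
Qed.

Lemma or_eq_substr x y z : eq y z * lt x y = eq y z * lt x z.
Proof.
apply: local_eq => [|U q]; first exact: or_eq_idem.
by rewrite (or_eq_nat O) !(or_lt_nat O) => /(or_eqP O) ->.
Qed.

Lemma or_eq_trans x y z : eq x y * eq y z = eq x y * eq x z.
Proof.
apply: local_eq => [|U q]; first exact: or_eq_idem.
by rewrite !(or_eq_nat O) => /(or_eqP O) ->.
Qed.

Lemma or_eq_sym x y : eq x y = eq y x.
Proof.
have E (a b : chom D X) : eq a b * 1 = eq a b * eq b a.
  by rewrite or_eq_trans or_eq_refl.
by rewrite -[LHS]mulr1 E mulrC -E mulr1.
Qed.

Lemma idem_mul (R : comPzRingType) (a b : R) :
  a * a = a -> b * b = b -> (a * b) * (a * b) = a * b.
Proof. by move=> ea eb; rewrite mulrACA ea eb. Qed.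

Lemma idem_mul1 (R : comPzRingType) (a b : R) :
  a * a = a -> a * b = 1 -> a = 1.
Proof. by move=> ea e; rewrite -[a]mulr1 -e mulrA ea. Qed.

Lemma or_lt_trans x y z : lt x y * lt y z * lt x z = lt x y * lt y z.
Proof.
rewrite -[RHS]mulr1; apply: local_eq => [|U q].
  by apply: idem_mul; apply: or_lt_idem.
rewrite pullM pull1 !(or_lt_nat O) => E.
have E1 : lt (x \k q) (y \k q) = 1.
  apply: idem_mul1 E; rewrite -(or_lt_nat O) -pullM; congr pull; exact: or_lt_idem.
by move: E; rewrite E1 mul1r; apply: (or_trans O E1).
Qed.
End Theory.

Section OfTotalOrder.
Variables (X : S) (XX : product_of X X) (R : subobject XX).

(** The three summands of X x X give idempotents r, d, r'; a relation at (x, y) is the pullback of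
    such an idempotent along that point. *)
Lemma ordered_rel_of_total : is_total_order R ->
  exists lt eq : point_rel X,
    ordered_rel lt eq /\ sloc (sub_map R) (lt XX (pr1 XX) (pr2 XX)).
Proof.
move=> [[diag [[diag1 diag2] [sw [[sw1 sw2] cop]]]] tr].
have [r [d [r' [Lr Ld Lr' [s12 o12 o13 o23]]]]] := loc_of_coproduct3 cop.
have swK : sw \k sw = cid XX.
  by apply: pair_eq; rewrite ccompA ?sw1 ?sw2 ?sw1 ?sw2 ccomp1r.
(* Hence r' at (x, y) is r at (y, x). *)
have Er' : r' = pull sw r.
  apply: (loc_unique Lr'); exact: (loc_iso (f := sw) (g := sw) swK swK Lr).
(* [XX] gives pairings of points by mere existence, whereas a relation is a function of its points.
   The tensor product supplies a function through [copair], carried over to [XX] by [g]. *)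
have [E] := tensor_etale X X.
pose Q : product_of X X := ProductOf (tensor_is_product E).
have [g [g1 g2]] := pair_exists XX (pr1 Q) (pr2 Q).
pose pt (D : S) (x y : chom D X) : @chom S D Q := copair (et_alg D) x y.
have pt1 (D : S) (x y : chom D X) : pr1 Q \k pt D x y = x.
  by apply: alg_hom_inj; apply: copair_in1.
have pt2 (D : S) (x y : chom D X) : pr2 Q \k pt D x y = y.
  by apply: alg_hom_inj; apply: copair_in2.
have gpt (D : S) (h : chom D XX) x y : is_pair h x y -> g \k pt D x y = h.
  by move=> [h1 h2]; apply: pair_eq; rewrite ccompA ?g1 ?g2 ?pt1 ?pt2 ?h1 ?h2.
pose lt : point_rel X := fun D x y => pull (g \k pt D x y) r.
pose eq : point_rel X := fun D x y => pull (g \k pt D x y) d.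
have ltE (D : S) (h : chom D XX) x y : is_pair h x y -> lt D x y = pull h r.
  by move=> H; rewrite /lt (gpt _ _ _ _ H).
have eqE (D : S) (h : chom D XX) x y : is_pair h x y -> eq D x y = pull h d.
  by move=> H; rewrite /eq (gpt _ _ _ _ H).
have gtE (D : S) (h : chom D XX) x y : is_pair h x y -> lt D y x = pull h r'.
  move=> [h1 h2]; rewrite Er' -pull_comp; apply: ltE.
  by split; rewrite ccompA ?sw1 ?sw2.
have pair_comp (D D' : S) (f : chom D' D) (h : chom D XX) x y :
    is_pair h x y -> is_pair (h \k f) (x \k f) (y \k f).
  by move=> [h1 h2]; split; rewrite ccompA ?h1 ?h2.
exists lt, eq; split; last first.
  rewrite (ltE XX (cid XX)); last by split; rewrite ccomp1r.
  by rewrite [pull _ _]gmap_id.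
split.
- move=> D D' f x y; have [h H] := pair_exists XX x y.
  by rewrite (ltE _ _ _ _ H) (ltE _ _ _ _ (pair_comp _ _ f _ _ _ H)) pull_comp.
- move=> D D' f x y; have [h H] := pair_exists XX x y.
  by rewrite (eqE _ _ _ _ H) (eqE _ _ _ _ (pair_comp _ _ f _ _ _ H)) pull_comp.
- move=> D x y; have [h H] := pair_exists XX x y.
  by rewrite (ltE _ _ _ _ H) (eqE _ _ _ _ H) (gtE _ _ _ _ H) -!pullD s12 pull1.
- move=> D x y; have [h H] := pair_exists XX x y.
  by rewrite (ltE _ _ _ _ H) (eqE _ _ _ _ H) -!pullM o12 pull0.
- move=> D x y; have [h H] := pair_exists XX x y.
  by rewrite (ltE _ _ _ _ H) (gtE _ _ _ _ H) -!pullM o13 pull0.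
- move=> D x y; have [h H] := pair_exists XX x y.
  by rewrite (eqE _ _ _ _ H) (gtE _ _ _ _ H) -!pullM o23 pull0.
- move=> D x y; have [h H] := pair_exists XX x y.
  rewrite (eqE _ _ _ _ H); split.
    move=> /(sloc_factor Ld) [l lh]; case: H => <- <-.
    by rewrite -lh !ccompA diag1 diag2.
  move=> xy; have -> : h = diag \k x.
    by case: H => h1 h2; apply: pair_eq; rewrite ccompA ?diag1 ?diag2 ccomp1l ?h1 ?h2.
  exact: (sloc_factor_pull x Ld).
- move=> D x y z.
  (* The point (x, y, z) of [X3] factors through [R12] and [R23], hence through their intersection
     and so through [R13]. *)
  have [X3 [p12 [p23 [p13 [[q12 q23 q13]]]]]] := tr.
  move=> [R12 [R23 [R13 [I [[g12 [c12 u12]] [g23 [c23 u23]] [g13 [c13 u13]]]]]]].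
  move=> [a [b [ca [cb ui]]]] [u cu].
  have [h H] := pair_exists XX x y; have [w W] := pair_exists X3 h z.
  have Hyz : is_pair (p23 \k w) y z.
    case: q23 => q1 q2; case: W => w1 w2; case: H => h1 h2.
    by split; rewrite ccompA ?q1 ?q2 // -ccompA w1 h2.
  have Hxz : is_pair (p13 \k w) x z.
    case: q13 => q1 q2; case: W => w1 w2; case: H => h1 h2.
    by split; rewrite ccompA ?q1 ?q2 // -ccompA w1 h1.
  have Hxy : is_pair (p12 \k w) x y.
    case: q12 => q1 q2; case: W => w1 w2; case: H => h1 h2.
    by split; rewrite ccompA ?q1 ?q2 // -ccompA w1 ?h1 ?h2.
  rewrite (ltE _ _ _ _ Hxy) (ltE _ _ _ _ Hyz) (ltE _ _ _ _ Hxz).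
  move=> /(sloc_factor Lr) [l12 e12] /(sloc_factor Lr) [l23 e23].
  have [m12 [[m12a m12b] _]] := u12 _ _ _ (esym e12).
  have [m23 [[m23a m23b] _]] := u23 _ _ _ (esym e23).
  have [n [[na nb] _]] := ui _ m12 m23 (etrans m12a (esym m23a)).
  have -> : p13 \k w = sub_map R \k g13 \k u \k n.
    rewrite !(ccompA (sub_map R)) -c13 -!ccompA; congr (_ \k _).
    by rewrite (ccompA (sub_map R13)) cu -ca -ccompA na.
  exact: (sloc_factor_pull _ Lr).
Qed.
End OfTotalOrder.

Section ToTotalOrder.
Variables (X : S) (lt eq : point_rel X) (XX : product_of X X) (R : subobject XX).
Hypotheses (O : ordered_rel lt eq).
Hypothesis LR : sloc (sub_map R) (lt (pr1 XX) (pr2 XX)).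

Lemma pull_pair_lt (D : S) (h : chom D XX) x y :
  is_pair h x y -> pull h (lt (pr1 XX) (pr2 XX)) = lt x y.
Proof. by move=> [h1 h2]; rewrite (or_lt_nat O) h1 h2. Qed.

(** By [or_eqP] the diagonal is the locus of [x = y], and the switched relation is that of [y < x];
    three orthogonal idempotents of sum 1 make a coproduct. *)
Lemma rel_trichotomy : order_trichotomy R.
Proof.
have [diag Hd] := pair_exists XX (cid X) (cid X); exists diag; split=> //.
have [sw Hs] := pair_exists XX (pr2 XX) (pr1 XX); exists sw; split=> //.
case: Hd Hs => [d1 d2] [sw1 sw2].
have swK : sw \k sw = cid XX.
  by apply: pair_eq; rewrite ccompA ?sw1 ?sw2 ?sw1 ?sw2 ccomp1r.
have Ld : sloc diag (eq (pr1 XX) (pr2 XX)).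
  apply: (sloc_univ HT (or_eq_idem O _ _)).
    by rewrite (or_eq_nat O) d1 d2 (or_eq_refl O).
  move=> D f; rewrite (or_eq_nat O) => /(or_eqP O) E.
  exists (pr1 XX \k f); split.
    by apply: pair_eq; rewrite ccompA ?d1 ?d2 ccomp1l.
  by move=> l <-; rewrite ccompA d1 ccomp1l.
have Lg : sloc (sw \k sub_map R) (lt (pr2 XX) (pr1 XX)).
  have -> : lt (pr2 XX) (pr1 XX) = pull sw (lt (pr1 XX) (pr2 XX)).
    by rewrite (or_lt_nat O) sw1 sw2.
  exact: (loc_iso (f := sw) (g := sw) swK swK LR).
exact: (coproduct3_of_loc LR Ld Lg (or_total O _ _) (or_lt_eq O _ _)
          (or_lt_gt O _ _) (or_eq_gt O _ _)).
Qed.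

Lemma sloc_inverse_image (D : S) (f : chom D XX) x y (U : subobject D) :
  is_pair f x y -> sloc (sub_map U) (lt x y) -> is_inverse_image f R U.
Proof.
move=> H L; have [g gE] : exists g : chom U R, sub_map R \k g = f \k sub_map U.
  by apply: (sloc_factor LR); rewrite pull_comp (pull_pair_lt H) sloc_pull.
exists g; split=> [//|D' a b E].
have [h hE] : exists h : chom D' U, sub_map U \k h = a.
  apply: (sloc_factor L).
  by rewrite -(pull_pair_lt H) -pull_comp E pull_comp (sloc_pull LR) pull1.
exists h; split; last by move=> h' [E' _]; apply: (@sub_mono _ _ U); rewrite hE E'.
split=> //; apply: (@sub_mono _ _ R).
by rewrite ccompA gE -ccompA hE E.
Qed.

Lemma sloc_intersection (D : S) (U V W : subobject D) e f :
  sloc (sub_map U) e -> sloc (sub_map V) f -> sloc (sub_map W) (e * f) ->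
  is_intersection U V W.
Proof.
move=> LU LV LW; have W1 := sloc_pull LW; rewrite pullM in W1.
have E1 : pull (sub_map W) e = 1.
  by apply: idem_mul1 W1; rewrite -pullM (loc_idem LU).
have E2 : pull (sub_map W) f = 1 by move: W1; rewrite E1 mul1r.
have [a aE] := sloc_factor LU E1; have [b bE] := sloc_factor LV E2.
exists a, b; split=> //; split=> [|D' u v E]; first by rewrite aE bE.
have [h hE] : exists h : chom D' W, sub_map W \k h = sub_map U \k u.
  apply: (sloc_factor LW).
  by rewrite pullM (sloc_factor_pull _ LU) E (sloc_factor_pull _ LV) mul1r.
exists h; split.
  split; [apply: (@sub_mono _ _ U)|apply: (@sub_mono _ _ V)];
    by rewrite ccompA ?aE ?bE hE.
move=> h' [ha _]; apply: (@sub_mono _ _ W).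
by rewrite hE -ha ccompA aE.
Qed.

Lemma rel_transitivity : order_transitivity R.
Proof.
have [X3] := product_of_exists XX X; exists X3.
set x1 := pr1 XX \k pr1 X3; set x2 := pr2 XX \k pr1 X3; set x3 := pr2 X3.
have [p12 H12] := pair_exists XX x1 x2; have [p23 H23] := pair_exists XX x2 x3.
have [p13 H13] := pair_exists XX x1 x3.
exists p12, p23, p13; split=> //.
have [R12 L12] := sloc_exists HT (or_lt_idem O x1 x2).
have [R23 L23] := sloc_exists HT (or_lt_idem O x2 x3).
have [R13 L13] := sloc_exists HT (or_lt_idem O x1 x3).
have [I LI] := sloc_exists HT (idem_mul (or_lt_idem O x1 x2) (or_lt_idem O x2 x3)).
exists R12, R23, R13, I; split.
- exact: sloc_inverse_image H12 L12.
- exact: sloc_inverse_image H23 L23.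
- exact: sloc_inverse_image H13 L13.
- exact: sloc_intersection L12 L23 LI.
- apply: (sloc_factor L13); have I1 := sloc_pull LI.
  by move: (I1); rewrite -(or_lt_trans O) pullM I1 mul1r.
Qed.

Lemma total_of_ordered_rel : is_total_order R.
Proof. by split; [exact: rel_trichotomy | exact: rel_transitivity]. Qed.
End ToTotalOrder.

Section Lex.
Variables (X Y : S) (ltX eqX : point_rel X) (ltY eqY : point_rel Y).
Hypotheses (OX : ordered_rel ltX eqX) (OY : ordered_rel ltY eqY).
Variable Z : product_of X Y.

Definition lex_lt : point_rel Z := fun D z z' =>
  ltX (pr1 Z \k z) (pr1 Z \k z') +
  eqX (pr1 Z \k z) (pr1 Z \k z') * ltY (pr2 Z \k z) (pr2 Z \k z').
Definition lex_eq : point_rel Z := fun D z z' =>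
  eqX (pr1 Z \k z) (pr1 Z \k z') * eqY (pr2 Z \k z) (pr2 Z \k z').

Lemma lex_ordered_rel : ordered_rel lex_lt lex_eq.
Proof.
split; rewrite /lex_lt /lex_eq.
- by move=> D E f z z'; rewrite pullD pullM !(or_lt_nat OX, or_lt_nat OY, or_eq_nat OX) -!ccompA.
- by move=> D E f z z'; rewrite pullM (or_eq_nat OX) (or_eq_nat OY) -!ccompA.
- move=> D z z'; have tX := or_total OX (pr1 Z \k z) (pr1 Z \k z').
  have tY := or_total OY (pr2 Z \k z) (pr2 Z \k z').
  rewrite (or_eq_sym OX (pr1 Z \k z') (pr1 Z \k z)).
  move: tX tY; set a := ltX _ _; set d := eqX _ _; set a' := ltX _ _.
  set b := ltY _ _; set d' := eqY _ _; set b' := ltY _ _ => tX tY.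
  have -> : a + d * b + d * d' + (a' + d * b') = a + d * (b + d' + b') + a'.
    by ring.
  by rewrite tY mulr1.
- move=> D z z'; rewrite mulrDl mulrA (or_lt_eq OX) mul0r add0r.
  by rewrite mulrACA (or_lt_eq OY) mulr0.
- move=> D z z'; rewrite (or_eq_sym OX (pr1 Z \k z') (pr1 Z \k z)).
  rewrite mulrDl !mulrDr (or_lt_gt OX) mulrA (or_lt_eq OX) mul0r !add0r.
  rewrite mulrAC (or_eq_gt OX) mul0r add0r mulrACA (or_lt_gt OY).
  by rewrite mulr0.
- move=> D z z'; rewrite (or_eq_sym OX (pr1 Z \k z') (pr1 Z \k z)) mulrDr.
  by rewrite mulrAC (or_eq_gt OX) mul0r add0r mulrACA (or_eq_gt OY) mulr0.
- move=> D z z'; split=> [E|->]; last first.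
    by rewrite (or_eq_refl OX) (or_eq_refl OY) mulr1.
  have E1 := idem_mul1 (or_eq_idem OX _ _) E.
  move: E; rewrite E1 mul1r => E2.
  by apply: pair_eq; [apply/(or_eqP OX)|apply/(or_eqP OY)].
- move=> D z1 z2 z3.
  move: (pr1 Z \k z1) (pr1 Z \k z2) (pr1 Z \k z3) => x1 x2 x3.
  move: (pr2 Z \k z1) (pr2 Z \k z2) (pr2 Z \k z3) => y1 y2 y3.
  move=> H12 H23.
  (* The complement of [z1 < z3]. Expanding 1 = [z1 < z2][z2 < z3] gives four products, each lying
     below one of the two summands of [z1 < z3] and so killed by [u]; hence [u] = 0. *)
  pose u := 1 - (ltX x1 x3 + eqX x1 x3 * ltY y1 y3).
  have ua : ltX x1 x3 * u = 0.
    by rewrite /u mulrBr mulrDr mulr1 (or_lt_idem OX) mulrA (or_lt_eq OX) mul0r addr0 subrr.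
  have ub : eqX x1 x3 * ltY y1 y3 * u = 0.
    rewrite /u mulrBr mulrDr mulr1 mulrAC [eqX _ _ * ltX _ _]mulrC.
    rewrite (or_lt_eq OX) mul0r add0r mulrACA (or_eq_idem OX).
    by rewrite (or_lt_idem OY) subrr.
  have t1 : ltX x1 x2 * ltX x2 x3 * u = 0.
    by rewrite -(or_lt_trans OX) -mulrA ua mulr0.
  have t2 : ltX x1 x2 * eqX x2 x3 * u = 0.
    by rewrite [ltX x1 x2 * _]mulrC (or_eq_substr OX) -mulrA ua mulr0.
  have t3 : eqX x1 x2 * ltX x2 x3 * u = 0.
    by rewrite (or_eq_subst OX) -mulrA ua mulr0.
  have t4 : eqX x1 x2 * eqX x2 x3 * (ltY y1 y2 * ltY y2 y3) * u = 0.
    by rewrite (or_eq_trans OX) -(or_lt_trans OY) mulrACA -[LHS]mulrA ub mulr0.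
  suff : u = 0 by move/eqP; rewrite subr_eq0 => /eqP.
  rewrite -[u]mul1r -[1 in LHS](mulr1 1) -{1}H12 -H23.
  move: t1 t2 t3 t4; set a := ltX x1 x2; set a' := ltX x2 x3.
  set d := eqX x1 x2; set d' := eqX x2 x3; set b := ltY y1 y2; set b' := ltY y2 y3.
  move=> t1 t2 t3 t4.
  have -> : (a + d * b) * (a' + d' * b') * u = a * a' * u + b' * (a * d' * u) +
      b * (d * a' * u) + d * d' * (b * b') * u by ring.
  by rewrite t1 t2 t3 t4 !mulr0 !addr0.
Qed.
End Lex.
End Orders.

(** * The lexicographic order *)

Section Lexicographic.
Variables (k : fieldType) (T : tensor_category k).
Hypothesis HT : karoubian T.
Local Notation S := (EtOp T).
Variables (X Y : S) (ltX eqX : point_rel X) (ltY eqY : point_rel Y).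
Hypotheses (OX : ordered_rel ltX eqX) (OY : ordered_rel ltY eqY).
Variables (XX : product_of X X) (RX : subobject XX).
Variables (YY : product_of Y Y) (RY : subobject YY).
Variables (Z : product_of X Y) (ZZ : product_of Z Z).
Hypothesis LX : sloc (sub_map RX) (ltX (pr1 XX) (pr2 XX)).
Hypothesis LY : sloc (sub_map RY) (ltY (pr1 YY) (pr2 YY)).

Let x1 := pr1 Z \k pr1 ZZ.
Let y1 := pr2 Z \k pr1 ZZ.
Let x2 := pr1 Z \k pr2 ZZ.
Let y2 := pr2 Z \k pr2 ZZ.

Lemma coordinatesE (D : S) (h : chom D ZZ) a1 b1 a2 b2 :
  has_coordinates h a1 b1 a2 b2 <->
  [/\ x1 \k h = a1, y1 \k h = b1, x2 \k h = a2 & y2 \k h = b2].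
Proof.
rewrite /has_coordinates /is_pair /x1 /x2 /y1 /y2 -!ccompA.
by split=> [[[? ?] [? ?]]|[? ? ? ?]].
Qed.

Lemma coordinates_eq (D : S) (h h' : chom D ZZ) :
  x1 \k h = x1 \k h' -> y1 \k h = y1 \k h' -> x2 \k h = x2 \k h' ->
  y2 \k h = y2 \k h' -> h = h'.
Proof.
by rewrite /x1 /x2 /y1 /y2 -!ccompA => ? ? ? ?; apply: pair_eq; apply: pair_eq.
Qed.

Lemma coordinates_exist (D : S) (a1 : chom D X) (b1 : chom D Y) a2 b2 :
  exists h : chom D ZZ, has_coordinates h a1 b1 a2 b2.
Proof.
have [u Hu] := pair_exists Z a1 b1; have [v Hv] := pair_exists Z a2 b2.
have [h [h1 h2]] := pair_exists ZZ u v.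
by exists h; split; rewrite ?h1 ?h2.
Qed.

(** At a point of the locus [x1 < x2], the X-coordinates factor through [RX] and the Y-coordinates
    are free: these are the data of a point of [P]. *)
Lemma sloc_lex_fst (P : product_of RX YY) (h : chom P ZZ) :
  has_coordinates h
    (pr1 XX \k (sub_map RX \k pr1 P)) (pr1 YY \k pr2 P)
    (pr2 XX \k (sub_map RX \k pr1 P)) (pr2 YY \k pr2 P) ->
  sloc h (ltX x1 x2).
Proof.
move=> /coordinatesE [h1 h2 h3 h4].
apply: (sloc_univ HT (or_lt_idem OX _ _)).
  by rewrite (or_lt_nat OX) h1 h3 -(or_lt_nat OX) (sloc_factor_pull _ LX).
move=> D f; rewrite (or_lt_nat OX).
have [u Hu] := pair_exists XX (x1 \k f) (x2 \k f).
have [v [v1 v2]] := pair_exists YY (y1 \k f) (y2 \k f).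
rewrite -(pull_pair_lt OX Hu) => /(sloc_factor LX) [l lE].
have [w [w1 w2]] := pair_exists P l v; case: Hu => u1 u2.
exists w; split.
  apply: coordinates_eq.
  - by rewrite (ccompA x1) h1 -(ccompA (pr1 XX)) -(ccompA (sub_map RX)) w1 lE u1.
  - by rewrite (ccompA y1) h2 -(ccompA (pr1 YY)) w2 v1.
  - by rewrite (ccompA x2) h3 -(ccompA (pr2 XX)) -(ccompA (sub_map RX)) w1 lE u2.
  - by rewrite (ccompA y2) h4 -(ccompA (pr2 YY)) w2 v2.
move=> w' E; apply: pair_eq.
  apply: (@sub_mono _ _ RX); rewrite w1 lE; apply: pair_eq.
    by rewrite u1 -E (ccompA x1) h1 -(ccompA (pr1 XX)) -(ccompA (sub_map RX)).
  by rewrite u2 -E (ccompA x2) h3 -(ccompA (pr2 XX)) -(ccompA (sub_map RX)).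
rewrite w2; apply: pair_eq.
  by rewrite v1 -E (ccompA y1) h2 -(ccompA (pr1 YY)).
by rewrite v2 -E (ccompA y2) h4 -(ccompA (pr2 YY)).
Qed.

(** At a point of this locus the X-coordinates coincide and the Y-coordinates factor through [RY]:
    these are the data of a point of [Q]. *)
Lemma sloc_lex_snd (Q : product_of X RY) (h : chom Q ZZ) :
  has_coordinates h
    (pr1 Q) (pr1 YY \k (sub_map RY \k pr2 Q))
    (pr1 Q) (pr2 YY \k (sub_map RY \k pr2 Q)) ->
  sloc h (eqX x1 x2 * ltY y1 y2).
Proof.
move=> /coordinatesE [h1 h2 h3 h4].
apply: (sloc_univ HT).
- exact: idem_mul (or_eq_idem OX _ _) (or_lt_idem OY _ _).
- rewrite pullM (or_eq_nat OX) h1 h3 (or_eq_refl OX) mul1r.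
  by rewrite (or_lt_nat OY) h2 h4 -(or_lt_nat OY) (sloc_factor_pull _ LY).
move=> D f; rewrite pullM (or_eq_nat OX) (or_lt_nat OY) => E.
have E1 := idem_mul1 (or_eq_idem OX _ _) E.
move: E; rewrite E1 mul1r; move/(or_eqP OX): E1 => E1.
have [v Hv] := pair_exists YY (y1 \k f) (y2 \k f).
rewrite -(pull_pair_lt OY Hv) => /(sloc_factor LY) [l lE].
have [w [w1 w2]] := pair_exists Q (x1 \k f) l; case: Hv => v1 v2.
exists w; split.
  apply: coordinates_eq.
  - by rewrite (ccompA x1) h1 w1.
  - by rewrite (ccompA y1) h2 -(ccompA (pr1 YY)) -(ccompA (sub_map RY)) w2 lE v1.
  - by rewrite (ccompA x2) h3 w1 E1.
  - by rewrite (ccompA y2) h4 -(ccompA (pr2 YY)) -(ccompA (sub_map RY)) w2 lE v2.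
move=> w' E; apply: pair_eq; first by rewrite w1 -E (ccompA x1) h1.
apply: (@sub_mono _ _ RY); rewrite w2 lE; apply: pair_eq.
  by rewrite v1 -E (ccompA y1) h2 -(ccompA (pr1 YY)) -(ccompA (sub_map RY)).
by rewrite v2 -E (ccompA y2) h4 -(ccompA (pr2 YY)) -(ccompA (sub_map RY)).
Qed.

Lemma lex_orth : ltX x1 x2 * (eqX x1 x2 * ltY y1 y2) = 0.
Proof. by rewrite mulrA (or_lt_eq OX) mul0r. Qed.

Variable R : subobject ZZ.

Lemma sloc_of_lexicographic : is_lexicographic RX RY R ->
  sloc (sub_map R) (lex_lt ltX eqX ltY (pr1 ZZ) (pr2 ZZ)).
Proof.
move=> [P [Q [i [j [/sloc_lex_fst Li /sloc_lex_snd Lj cop]]]]].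
exact: (loc_glue Li Lj lex_orth cop).
Qed.

(** The loci of the two orthogonal summands of [lex_lt] lie inside [R], where their idempotents sum
    to 1. This serves to construct a lexicographic product. *)
Lemma lexicographic_of_sloc :
  sloc (sub_map R) (lex_lt ltX eqX ltY (pr1 ZZ) (pr2 ZZ)) ->
  is_lexicographic RX RY R.
Proof.
move=> L; have [P] := product_of_exists RX YY; have [Q] := product_of_exists X RY.
have [f Hf] := coordinates_exist
  (pr1 XX \k (sub_map RX \k pr1 P)) (pr1 YY \k pr2 P)
  (pr2 XX \k (sub_map RX \k pr1 P)) (pr2 YY \k pr2 P).
have [g Hg] := coordinates_exist
  (pr1 Q) (pr1 YY \k (sub_map RY \k pr2 Q))
  (pr1 Q) (pr2 YY \k (sub_map RY \k pr2 Q)).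
have Lf := sloc_lex_fst Hf; have Lg := sloc_lex_snd Hg.
have [i iE] : exists i : chom P R, sub_map R \k i = f.
  apply: (sloc_factor L); rewrite pullD.
  have := congr1 (pull f) lex_orth.
  by rewrite pullM pull0 (sloc_pull Lf) mul1r => ->; rewrite addr0.
have [j jE] : exists j : chom Q R, sub_map R \k j = g.
  apply: (sloc_factor L); rewrite pullD.
  have := congr1 (pull g) lex_orth.
  by rewrite pullM pull0 (sloc_pull Lg) mulr1 => ->; rewrite add0r.
exists P, Q, i, j; split; rewrite ?iE ?jE //.
rewrite -iE in Lf; rewrite -jE in Lg.
apply: (coproduct2_of_loc (loc_restrict L Lf) (loc_restrict L Lg)).
rewrite -gmapD; exact: (sloc_pull L).
Qed.
End Lexicographic.

(** * Traces *)

Section Gamma.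
Variables (k : fieldType) (T : tensor_category k).
Local Notation One := (unit_ob T).
Local Notation S := (EtOp T).

Definition sgamma (D C : S) (f : chom D C) (c : k) : Prop := @has_gamma k T C D f c.

Lemma sgamma_comp (C D E : S) (f : chom D C) (g : chom E D) a b :
  sgamma f a -> sgamma g b -> sgamma (f \k g) (b * a).
Proof.
move=> /has_gammaP Hf /has_gammaP Hg; apply/has_gammaP.
by rewrite /= compA Hg comp_Zl Hf scalerA.
Qed.

(** An isomorphism is a localization at the idempotent 1, which leaves the trace unchanged. *)
Lemma sgamma_iso (C D : S) (f : chom D C) (g : chom C D) :
  f \k g = cid C -> g \k f = cid D -> sgamma f 1.
Proof.
move=> /(congr1 (@ah_val _ _ _ _)) /= gf /(congr1 (@ah_val _ _ _ _)) /= fg.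
apply/has_gammaP; rewrite scale1r.
have L : @loc k T C D f 1.
  by exists g; rewrite [mu _](mu1 (et_alg (C : etale T))).
by rewrite (loc_trace L) [mu _](mu1 (et_alg (C : etale T))) comp1r.
Qed.

Lemma sgamma_id (C : S) : sgamma (cid C) 1.
Proof. by apply: (sgamma_iso (g := cid C)); rewrite ccomp1l. Qed.

Lemma product_iso (X Y : S) (P Q : product_of X Y) :
  exists (f : chom P Q) (g : chom Q P), [/\ f \k g = cid _, g \k f = cid _,
    pr1 Q \k f = pr1 P & pr2 Q \k f = pr2 P].
Proof.
have [f [f1 f2]] := pair_exists Q (pr1 P) (pr2 P).
have [g [g1 g2]] := pair_exists P (pr1 Q) (pr2 Q).
exists f, g; split=> //; apply: pair_eq; rewrite ccompA ccomp1r.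
- by rewrite f1.
- by rewrite f2.
- by rewrite g1.
- by rewrite g2.
Qed.

(** On tensor products the map is [f \om g] and traces multiply; arbitrary products are reached
    through isomorphisms, whose scalar is 1. *)
Lemma sgamma_prod (X Y U V : S) (Z : product_of X Y) (P : product_of U V)
    (h : chom P Z) (f : chom U X) (g : chom V Y) a b :
  pr1 Z \k h = f \k pr1 P -> pr2 Z \k h = g \k pr2 P ->
  sgamma f a -> sgamma g b -> sgamma h (a * b).
Proof.
move=> h1 h2 Hf Hg; have [EZ] := tensor_etale X Y; have [EP] := tensor_etale U V.
pose Z0 : product_of X Y := ProductOf (tensor_is_product EZ).
pose P0 : product_of U V := ProductOf (tensor_is_product EP).
have [z [z' [zz' z'z z1 z2]]] := product_iso Z0 Z.
have [p [p' [pp' p'p p1 p2]]] := product_iso P P0.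
pose h0 : chom P0 Z0 := @copair k T X Y (Etale EP) (et_alg (Etale EP))
  (f \k pr1 P0 : @chom S _ _) (g \k pr2 P0 : @chom S _ _).
have h01 : pr1 Z0 \k h0 = f \k pr1 P0 by apply: alg_hom_inj; apply: copair_in1.
have h02 : pr2 Z0 \k h0 = g \k pr2 P0 by apply: alg_hom_inj; apply: copair_in2.
have h0E : ah_val h0 = ah_val f \om ah_val g.
  rewrite /h0 /= tensm_comp compA.
  have := tensor_in_mul (et_alg (U : etale T)) (et_alg (V : etale T)).
  by rewrite /= => ->; rewrite comp1l.
have H0 : sgamma h0 (a * b).
  move: Hf Hg => /has_gammaP Hf /has_gammaP Hg; apply/has_gammaP.
  rewrite (tensor_traceE EP) (tensor_traceE EZ) h0E -compA -tensm_comp Hf Hg.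
  by rewrite tensm_Zl tensm_Zr scalerA comp_Zr.
have -> : h = z \k (h0 \k p).
  apply: pair_eq; rewrite ccompA ?z1 ?z2 ccompA ?h01 ?h02 -ccompA ?p1 ?p2 //.
have := sgamma_comp (sgamma_iso zz' z'z) (sgamma_comp H0 (sgamma_iso pp' p'p)).
by rewrite mul1r mulr1.
Qed.

(** The trace of x (x) 1 is that of x times the trace of 1 in the other factor, which is its
    dimension. *)
Lemma sgamma_pr1 (X Y : S) (P : product_of X Y) d :
  dimension (et_dual (Y : etale T)) = d *: idm One -> sgamma (pr1 P) d.
Proof.
rewrite dimension_trace => dY; have [E] := tensor_etale X Y.
pose P0 : product_of X Y := ProductOf (tensor_is_product E).
have [p [p' [pp' p'p p1 p2]]] := product_iso P P0.
have H0 : sgamma (pr1 P0) d.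
  apply/has_gammaP; rewrite (tensor_traceE E) /= /tensor_in1.
  rewrite -compA (compA (_ \om _)) -tensm_comp comp1r [X in _ \om X]dY.
  by rewrite tensm_Zr comp_Zl comp_Zr compA lunit_runit runit_nat -compA runitVK comp1r.
rewrite -p1 -[d]mul1r; apply: sgamma_comp H0 _.
exact: sgamma_iso pp' p'p.
Qed.

Lemma sgamma_pr2 (X Y : S) (P : product_of X Y) d :
  dimension (et_dual (X : etale T)) = d *: idm One -> sgamma (pr2 P) d.
Proof.
rewrite dimension_trace => dX; have [E] := tensor_etale X Y.
pose P0 : product_of X Y := ProductOf (tensor_is_product E).
have [p [p' [pp' p'p p1 p2]]] := product_iso P P0.
have H0 : sgamma (pr2 P0) d.
  apply/has_gammaP; rewrite (tensor_traceE E) /= /tensor_in2.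
  rewrite -compA (compA (_ \om _)) -tensm_comp comp1r [X in X \om _]dX.
  by rewrite tensm_Zl comp_Zl comp_Zr compA lunit_nat -compA lunitVK comp1r.
rewrite -p2 -[d]mul1r; apply: sgamma_comp H0 _.
exact: sgamma_iso pp' p'p.
Qed.

Lemma sgamma_coproduct (X R P Q : S) (h : chom R X) (i : chom P R)
    (j : chom Q R) a b :
  is_coproduct2 i j -> sgamma (h \k i) a -> sgamma (h \k j) b ->
  sgamma h (a + b).
Proof.
move=> cop /has_gammaP Hi /has_gammaP Hj; apply/has_gammaP.
by rewrite (trace_coproduct2 cop) comp_Dl scalerDl -Hi -Hj /= !compA.
Qed.

Lemma eta_gamma (C : etale T) c :
  has_gamma (eta C) c <-> dimension (et_dual C) = c *: idm One.
Proof.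
rewrite dimension_trace; split=> [/has_gammaP|H]; last apply/has_gammaP.
  by rewrite /trace unit_trace.
by rewrite /= H /trace unit_trace.
Qed.

(** * Invariants of the lexicographic product *)

Section LexGamma.
Hypothesis HT : karoubian T.
Variables (A B : ordered_etale T) (L : lex_product A B).
Let Z := lex_prod L.
Let ZZ := lex_sq L.
Let R := lex_ord L.

Lemma lex_total : is_total_order R.
Proof.
have [ltA [eqA [OA LA]]] := ordered_rel_of_total (oe_total A).
have [ltB [eqB [OB LB]]] := ordered_rel_of_total (oe_total B).
apply: (total_of_ordered_rel HT (lex_ordered_rel HT OA OB Z)).
exact: (sloc_of_lexicographic HT OA OB LA LB (lex_ordP L)).
Qed.

Variable dB : k.
Hypothesis dimB : dimension (et_dual B) = dB *: idm One.

(** Over the first summand of the order the projection is that of the relation of A times a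
    projection of B x B, contributing a dim B; over the second it is the identity of A times the
    projection for B, contributing b. *)
Lemma lex_gamma1 a b :
  has_gamma (oe_pi1 A) a -> has_gamma (oe_pi1 B) b ->
  has_gamma (oe_pi1 (lex_ordered lex_total)) (a * dB + b).
Proof.
move=> Ha Hb; have [P [Q [i [j [[hP1 _] [hQ1 _] cop]]]]] := lex_ordP L.
case: hP1 hQ1 => [P1 P2] [Q1 Q2].
apply: (sgamma_coproduct (h := pr1 ZZ \k sub_map R) cop); rewrite -ccompA.
  apply: (sgamma_prod (f := pr1 (oe_sq A) \k sub_map (oe_ord A)) _ P2 Ha).
    by rewrite P1 ccompA.
  exact: sgamma_pr1 dimB.
rewrite -[b]mul1r.
apply: (sgamma_prod (f := cid _) (g := pr1 (oe_sq B) \k sub_map (oe_ord B)) _ _ _ Hb).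
- by rewrite Q1 ccomp1l.
- by rewrite Q2 ccompA.
- exact: sgamma_id.
Qed.

Lemma lex_gamma2 a b :
  has_gamma (oe_pi2 A) a -> has_gamma (oe_pi2 B) b ->
  has_gamma (oe_pi2 (lex_ordered lex_total)) (a * dB + b).
Proof.
move=> Ha Hb; have [P [Q [i [j [[_ hP1] [_ hQ1] cop]]]]] := lex_ordP L.
case: hP1 hQ1 => [P1 P2] [Q1 Q2].
apply: (sgamma_coproduct (h := pr2 ZZ \k sub_map R) cop); rewrite -ccompA.
  apply: (sgamma_prod (f := pr2 (oe_sq A) \k sub_map (oe_ord A)) _ P2 Ha).
    by rewrite P1 ccompA.
  exact: sgamma_pr2 dimB.
rewrite -[b]mul1r.
apply: (sgamma_prod (f := cid _) (g := pr2 (oe_sq B) \k sub_map (oe_ord B)) _ _ _ Hb).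
- by rewrite Q1 ccomp1l.
- by rewrite Q2 ccompA.
- exact: sgamma_id.
Qed.

Lemma lex_dimension dA : dimension (et_dual A) = dA *: idm One ->
  dimension (et_dual (lex_ordered lex_total)) = (dA * dB) *: idm One.
Proof.
move: dimB; rewrite !dimension_trace => eB eA.
rewrite (tensor_traceE (lex_etale L)) /= -compA (compA (_ \om _)) -tensm_comp.
rewrite [X in X \om _]eA [X in _ \om X]eB tensm_Zl tensm_Zr scalerA comp_Zl comp_Zr.
by rewrite tensm1 comp1l lunitVK.
Qed.
End LexGamma.

Lemma lex_product_exists (A B : ordered_etale T) :
  karoubian T -> inhabited (lex_product A B).
Proof.
move=> HT.
have [ltA [eqA [OA LA]]] := ordered_rel_of_total (oe_total A).
have [ltB [eqB [OB LB]]] := ordered_rel_of_total (oe_total B).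
have [E] := tensor_etale A B.
pose Z : product_of (A : S) (B : S) := ProductOf (tensor_is_product E).
have [ZZ] := product_of_exists Z Z.
have O := lex_ordered_rel HT OA OB Z.
have [R LR] := sloc_exists HT (or_lt_idem O (pr1 ZZ) (pr2 ZZ)).
have H := lexicographic_of_sloc HT OA OB LA LB LR.
by constructor; apply: (@LexProduct _ _ A B E (tensor_pr1 E) (tensor_pr2 E)
  erefl erefl (tensor_is_product E) ZZ R H).
Qed.

Lemma is_zero_tens_l (X Y : T) : is_zero X -> is_zero (X \ox Y).
Proof. by rewrite /is_zero -tensm1 => ->; rewrite tensm_0l. Qed.

Lemma is_zero_tens_r (X Y : T) : is_zero Y -> is_zero (X \ox Y).
Proof. by rewrite /is_zero -tensm1 => ->; rewrite tensm_0r. Qed.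

Lemma is_zero_One (X : T) : is_zero One -> is_zero X.
Proof.
move=> /(is_zero_tens_l X) H; rewrite /is_zero -(lunitVK X) -[lunit X]comp1r.
by rewrite H comp_0r comp_0l.
Qed.

Lemma zero_dimension (C : etale T) d :
  is_zero C -> dimension (et_dual C) = d *: idm One -> ~ is_zero One -> d = 0.
Proof.
rewrite dimension_trace => C0; rewrite -(comp1l (alg_unit C)) C0 comp_0l comp_0r.
move=> /esym/eqP; rewrite scaler_eq0 => /orP[/eqP //|/eqP O1] O1'.
by case: O1'.
Qed.

(** The origin of the table: for instance 2 x 1 = 3, since type 1 has dimension -1 and (0, (-1)(-1)
    - 1, 0 - 1) = (0, 0, -1). *)
Lemma lex_types (i j : delannic_index) :
  let: (d, c2, c1) := @type_values k i in
  let: (d', c2', c1') := @type_values k j in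
  @type_values k (index_mul i j) = (d * d', c2 * d' + c2', c1 * d' + c1').
Proof.
by case: i; case: j; rewrite /= !(mulrNN, mul1r, mulr1, mulr0, mul0r, mulN1r,
  add0r, addr0, subrr, oppr0, opprK).
Qed.

(** For the case of non-zero factors with zero tensor product: one of the types is 2 or 3, and
    multiplication by any type on either side stays among 2 and 3. *)
Lemma zero_dim_index (i j : delannic_index) :
  (@type_values k i).1.1 * (@type_values k j).1.1 = 0 ->
  index_mul i j = type2 \/ index_mul i j = type3.
Proof.
move=> H; move: H; case: i; case: j => //=; rewrite ?(mulrNN, mulr1, mul1r);
  by [left | right | move=> /eqP; rewrite ?oppr_eq0 oner_eq0].
Qed.
End Gamma.

Theorem proposition7p21 (k : fieldType) (T : tensor_category k)
    (HT : karoubian T) (A B : ordered_etale T) (i j : delannic_index)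
    (hA : delannic_of_type A i) (hB : delannic_of_type B j) :
  inhabited (lex_product A B) /\
  forall L : lex_product A B,
    exists tot : is_total_order (lex_ord L),
      delannic_of_type (lex_ordered tot) (index_mul i j).
Proof.
split=> [|L]; first exact: lex_product_exists.
exists (lex_total HT L).
set C := lex_ordered _.
have zeroC : is_zero C -> (index_mul i j = type2 \/ index_mul i j = type3) ->
    delannic_of_type C (index_mul i j).
  by move=> C0 ij; split; left.
(* A zero factor has type 2 or 3, so the product type is again 2 or 3, as the zero algebra
   requires. *)
case: hA hB => _ [[A0 iE] _|[nzA hA]].
  apply: zeroC; first exact: is_zero_tens_l.
  by case: iE => ->; case: (j); rewrite /=; auto.
case=> _ [[B0 jE]|[nzB hB]].
  apply: zeroC; first exact: is_zero_tens_r.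
  by case: jE => ->; case: (i); rewrite /=; auto.
move: hA hB (lex_types k i j) (@zero_dim_index k i j).
case: (@type_values k i) => [[dA c2A] c1A]; case: (@type_values k j) => [[dB c2B] c1B].
move=> [dimA g2A g1A] [dimB g2B g1B] /= tE ij0.
have dimC := lex_dimension HT L dimB dimA.
have g1C := lex_gamma1 HT L dimB g1A g1B.
have g2C := lex_gamma2 HT L dimB g2A g2B.
(* A non-zero unit object is what allows the scalar to be read off from a vanishing dimension. *)
have nzO : ~ is_zero (unit_ob T) by move/(is_zero_One A).
have [C0|nzC] := eqVneq (idm C) 0.
  by apply: zeroC => //; apply: ij0; apply: zero_dimension dimC nzO.
have {}nzC : ~ is_zero C by move/eqP: nzC.
split; right; split=> //; last by rewrite tE.
split; split=> //; [exists (dA * dB) | exists (c1A * dB + c1B) | exists (c2A * dB + c2B)] => //.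
by apply/eta_gamma.
Qed.
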